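(* Let $\Phi=(x(z),y(z))$ be an analytic curve in $\mathbb{CP}^2$ on the unit disc $\mathcal{D}\subset\mathbb{C}$, i.e. $\Phi(z)=[1:x(z):y(z)]$, with $x'y''-x''y'$ nowhere zero, and let $\kappa_0,\kappa_1$ be its Schwarzian curvatures. Let $z=z(w)$ be a change of coordinates in the disc $\mathcal{D}$, and let $\tilde\kappa_0,\tilde\kappa_1$ be the Schwarzian curvatures, with respect to $w$, of the curve $\tilde\Phi(w)=(x(z(w)),y(z(w)))$. Then $$\tilde\kappa_0={z'}^3\kappa_0+z'z''\kappa_1-Sz,\qquad \tilde\kappa_1={z'}^2\kappa_1-2\,Sz,$$ where $\kappa_0,\kappa_1$ are evaluated at $z(w)$, $z',z'',z'''$ are derivatives of $z$ with respect to $w$, and $Sz=\dfrac{z'''}{z'}-\dfrac32\left(\dfrac{z''}{z'}\right)^2$ is the Schwarzian derivative of the change of coordinates $z=z(w)$.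
   Context: For a curve in $\mathbb{CP}^2$ with holomorphic lifting $f$ to $\mathbb{C}^3\setminus\{0\}$ such that $f,f',f''$ are linearly independent (for $f=(1,x,y)$ this means $x'y''-x''y'\neq0$), choose an analytic nowhere-zero $\lambda$ with $\lambda^3\det[f,f',f'']=1$ and put $\nu=\lambda f$, so that $\det[\nu,\nu',\nu'']=1$. Then $\det[\nu,\nu',\nu''']=0$, so $\nu'''=\kappa_0\nu+\kappa_1\nu'$ for functions $\kappa_0,\kappa_1$; these are the Schwarzian curvatures of the curve. Derivatives of the curve are taken with respect to the coordinate on its domain.
   Formalization: The law for κ̃₀ is proved with −(Sz)' in place of the printed −Sz, which fails for general coordinate changes (e.g. x=z, y=z²/2, z=e^w−2); the printed formula is proved as stated only when z maps the disc biholomorphically onto itself. *)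

(* Defs.v *)
From HB Require Import structures.
From mathcomp Require Import all_boot all_order all_algebra.
From mathcomp Require Import complex.
From mathcomp Require Import boolp classical_sets functions reals topology
  normedtype sequences derive.

Set Implicit Arguments.
Unset Strict Implicit.
Unset Printing Implicit Defensive.

Import Order.TTheory GRing.Theory Num.Theory.
Import numFieldNormedType.Exports.

Local Open Scope classical_set_scope.
Local Open Scope ring_scope.

(* The field of complex numbers. Naming it as a numClosedFieldType gives access
   to the topology and to the derivatives derive1n n f that MathComp-Analysis
   defines over any numFieldType; over this field they are the complex
   derivatives.
   The norm is complex-valued, so `|t| < 1 is an inequality between reals seen
   as complex numbers. *)
Definition Cplx (R : realType) : numClosedFieldType := R[i].

Section SchwarzianCurvatures.
Variable R : realType.
Local Notation C := (Cplx R).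

Definition analytic_on (U : set C) (f : C -> C) : Prop :=
  forall a, U a -> exists c : nat -> C,
    \forall h \near (0 : C),
      series (fun n => c n * h ^+ n) @ \oo --> f (a + h).

Definition unit_disc : set C := [set t | `|t| < 1].

(* z is biholomorphic from U onto V: the inverse is required to be analytic. *)
Definition change_of_coordinates (U V : set C) (z : C -> C) : Prop :=
  [/\ open U, open V, analytic_on U z, (forall t, U t -> V (z t)) &
    exists w : C -> C, [/\ analytic_on V w, (forall s, V s -> U (w s)),
      (forall t, U t -> w (z t) = t) & (forall s, V s -> z (w s) = s)]].

Definition vderive (n : nat) (f : C -> 'cV[C]_3) (t : C) : 'cV[C]_3 :=
  \col_i derive1n n (fun s => f s i 0) t.

(* det [f, f', f''] *)
Definition wronskian (f : C -> 'cV[C]_3) (t : C) : C :=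
  \det (\matrix_(i < 3, j < 3) vderive j f t i 0).

(* Lifting to C^3 of the curve [1 : x : y] of the projective plane. *)
Definition affine_lift (x y : C -> C) (t : C) : 'cV[C]_3 :=
  \col_i [:: 1; x t; y t]`_i.

(* On U, kappa0 and kappa1 are the Schwarzian curvatures of the curve with
   lifting f. The normalisation lambda is unique up to a locally constant cube
   root of unity, hence kappa0 and kappa1 are determined on an open U. *)
Definition schwarzian_curvatures (U : set C) (f : C -> 'cV[C]_3)
    (kappa0 kappa1 : C -> C) : Prop :=
  exists lambda : C -> C,
    let nu t := lambda t *: f t in
    [/\ analytic_on U lambda,
        (forall t, U t -> lambda t != 0),
        (forall t, U t -> lambda t ^+ 3 * wronskian f t = 1) &
        (forall t, U t ->
          vderive 3 nu t = kappa0 t *: nu t + kappa1 t *: vderive 1 nu t)].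

Definition schwarzian (z : C -> C) (t : C) : C :=
  derive1n 3 z t / derive1n 1 z t
  - 3 / 2 * (derive1n 2 z t / derive1n 1 z t) ^+ 2.

End SchwarzianCurvatures.

Arguments unit_disc {R}.

(* Main.v *)
Require Import Defs.
From HB Require Import structures.
From mathcomp Require Import all_boot all_order all_algebra.
From mathcomp Require Import complex.
From mathcomp Require Import boolp classical_sets functions reals topology
  normedtype sequences derive.
From mathcomp Require Import ring lra.

Set Implicit Arguments.
Unset Strict Implicit.
Unset Printing Implicit Defensive.

Import Order.TTheory GRing.Theory Num.Theory.
Import numFieldNormedType.Exports.

Local Open Scope classical_set_scope.
Local Open Scope ring_scope.

(** Where [lambda] and [mu] normalise the two liftings,
    [(mu z')^3 = (lambda \o z)^3], so [mu z' / (lambda \o z)] is locally a constant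
    cube root of unity; this gives the derivatives of [mu] in terms of those of
    [lambda] and [z], and comparing the two third order equations coordinate by
    coordinate yields the transformation of the curvatures, with the derivative
    of [S z] as correction to [kappa_0].
    When [z] is an automorphism of the disc, the Schwarz-Pick inequality for [z]
    and for its inverse makes the Blaschke quotient of [z] unimodular, hence
    locally constant; so [z] is locally a Moebius map, and [S z] vanishes
    together with its derivative. *)

(** * The modulus and its topology *)

Section ComplexAnalysis.
Variable R : realType.
Local Notation C := (Cplx R).
Implicit Types (a b d h k t l x y : C) (f g : C -> C) (c u : nat -> C).

(** Rescaling [w] shows why the correction to [kappa_0] is a derivative: [kappa_0] has weight 3, as
    [(S z)'] has, while [S z] has weight 2. On the disc the formulas with [S z] and with [(S z)']
    agree because both quantities vanish, and this vanishing is what calls for function theory. That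
    theory is drawn from power series at a point, essentially by dividing out [t - a]. General
    products and inverses of expansions are never formed: the local maximum principle is stated for
    [mu + Q * E] with [Q] analytic and [E] merely continuous, which is the shape of a quotient near
    a value [mu]. On a closed disc, a maximum point of largest modulus takes the place of a
    connectedness argument. In the same spirit, the cube root of unity relating the two
    normalisations is never exhibited as a constant: what is extracted is the proportionality of the
    derivatives of [mu z'] and of [lambda \o z] up to order 3. *)

Definition cabs (x : Cplx R) : R := Normc.normc x.

(** The norm of [C] takes its values in [C]; this equation moves every estimate to the totally
    ordered field [R], where [lra] applies. *)
Lemma normcE x : `|x| = ((cabs x)%:C)%C.
Proof. by []. Qed.

Lemma cabs_ge0 x : 0 <= cabs x.
Proof. by case: x => u v; rewrite /cabs /= sqrtr_ge0. Qed.

Lemma cabsD x y : cabs (x + y) <= cabs x + cabs y.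
Proof. exact: le_normcD. Qed.

Lemma cabsM x y : cabs (x * y) = cabs x * cabs y.
Proof. exact: Normc.normcM. Qed.

Lemma cabsN x : cabs (- x) = cabs x.
Proof. exact: normcN. Qed.

Lemma cabs0 : cabs 0 = 0.
Proof. exact: Normc.normc0. Qed.

Lemma cabs1 : cabs 1 = 1.
Proof. exact: Normc.normc1. Qed.

Lemma cabsR (r : R) : cabs (r%:C)%C = `|r|.
Proof. by rewrite /cabs /= expr0n /= addr0 sqrtr_sqr. Qed.

Lemma cabs_eq0 x : (cabs x == 0) = (x == 0).
Proof. by apply/eqP/eqP => [/Normc.eq0_normc //|->]; rewrite cabs0. Qed.

Lemma cabs_gt0 x : (0 < cabs x) = (x != 0).
Proof. by rewrite lt_def cabs_ge0 andbT cabs_eq0. Qed.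

Lemma cabsX x n : cabs (x ^+ n) = cabs x ^+ n.
Proof. by elim: n => [|n IH]; rewrite ?expr0 ?cabs1 // !exprS cabsM IH. Qed.

Lemma cabsV x : cabs x^-1 = (cabs x)^-1.
Proof. exact: Normc.normcV. Qed.

Lemma cabs_distC x y : cabs (x - y) = cabs (y - x).
Proof. by rewrite -(cabsN (y - x)) opprB. Qed.

Lemma cabs_triangle x y z : cabs (x - z) <= cabs (x - y) + cabs (y - z).
Proof. by rewrite (le_trans _ (cabsD _ _))// addrA subrK. Qed.

Lemma cabs_le_dist x y : cabs x <= cabs y + cabs (x - y).
Proof. by rewrite addrC (le_trans _ (cabsD _ _))// subrK. Qed.

Lemma cabs_nat n : cabs n%:R = n%:R.
Proof.
have -> : (n%:R : C) = ((n%:R : R)%:C)%C by rewrite rmorph_nat.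
by rewrite cabsR ger0_norm.
Qed.

Lemma cnbhsP a (P : set C) :
  nbhs a P <-> exists2 r : R, 0 < r & forall t, cabs (t - a) < r -> P t.
Proof.
split=> [/nbhs_ballP[e /= e0 aP]|[r r0 aP]].
  have eE : e = ((complex.Re e)%:C)%C :> C by rewrite RRe_real // gtr0_real.
  exists (complex.Re e) => [|t ta]; first by move: e0; rewrite eE ltcR.
  by apply: aP; rewrite -ball_normE /ball_ /= distrC normcE eE ltcR.
apply/nbhs_ballP; exists (r%:C)%C; first by rewrite /= ltcR.
by move=> t; rewrite -ball_normE /ball_ /= distrC normcE ltcR; exact: aP.
Qed.

Lemma cnear_shiftP a (P : set C) :
  (\forall h \near (0 : C), P (a + h)) <-> nbhs a P.
Proof.
split=> /cnbhsP[r r0 aP]; apply/cnbhsP; exists r => // t ta.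
  by rewrite -(subrKC a t); apply: aP; rewrite subr0.
by apply: aP; rewrite addrAC subrr add0r -[t]subr0.
Qed.

Lemma ccvgP u l : u @ \oo --> l <->
  forall e : R, 0 < e -> exists m, forall n, (m <= n)%N -> cabs (u n - l) < e.
Proof.
split=> [ul e e0|ul A].
  have /ul[m _ mP] : nbhs l [set t | cabs (t - l) < e] by apply/cnbhsP; exists e.
  by exists m => n mn; exact: mP.
move=> /cnbhsP[r r0 lA]; have [m mP] := ul r r0.
by exists m => // n mn; apply: lA; exact: mP.
Qed.

Lemma ccontP f a : {for a, continuous f} <->
  forall e : R, 0 < e -> exists2 r : R, 0 < r &
    forall t, cabs (t - a) < r -> cabs (f t - f a) < e.
Proof.
split=> [fa e e0|fa A].
  have /fa/cnbhsP : nbhs (f a) [set t | cabs (t - f a) < e].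
    by apply/cnbhsP; exists e.
  by case=> r r0 rP; exists r.
move=> /cnbhsP[e /fa[r r0 rP] eP]; apply/cnbhsP; exists r => // t ta.
exact/eP/rP.
Qed.

Lemma ccvg_le u l b (B : R) :
  u @ \oo --> l -> (forall n, cabs (u n - b) <= B) -> cabs (l - b) <= B.
Proof.
move=> /ccvgP ul uB; apply/ler_addgt0Pr => e e0.
have [m mP] := ul e e0; have := mP m (leqnn m); rewrite cabs_distC => um.
have := cabs_triangle l (u m) b; have := uB m; lra.
Qed.

Lemma ccvg_unique u l l' : u @ \oo --> l -> u @ \oo --> l' -> l = l'.
Proof. by move=> ul ul'; apply: (cvg_unique _ ul ul'); exact: norm_hausdorff. Qed.

Lemma is_derive_quad f a d : (exists K : R, \forall h \near (0 : C),
    cabs (f (a + h) - f a - d * h) <= K * cabs h ^+ 2) -> is_derive a 1 f d.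
Proof.
move=> [K /cnbhsP[r r0 rP]].
have fd : (fun h => h^-1 *: ((f \o shift a) (h *: (1:C)) - f a)) @ 0^' --> d.
  move=> A /cnbhsP[e e0 eP].
  rewrite /= nbhs_filterE; apply/cnbhsP.
  (* [K] may be zero or negative; [|K| + 1] is a positive bound by which one can divide. *)
  have K1 : 0 < `|K| + 1 by rewrite ltr_wpDl.
  exists (Num.min r (e / (`|K| + 1))); first by rewrite lt_min r0 divr_gt0.
  move=> h; rewrite subr0 lt_min => /andP[hr he] h0.
  apply: eP.
  change (cabs (h^-1 * (f (h * 1 + a) - f a) - d) < e).
  rewrite mulr1 [h + a]addrC.
  have h0' : h != 0 by [].
  have -> : h^-1 * (f (a + h) - f a) - d = h^-1 * (f (a + h) - f a - d * h).
    by field.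
  have := rP h; rewrite subr0 => /(_ hr).
  rewrite cabsM cabsV => le.
  have hp : 0 < cabs h by rewrite cabs_gt0.
  rewrite ltr_pdivrMl //; apply: le_lt_trans le _.
  have : cabs h * (`|K| + 1) < e by rewrite -ltr_pdivlMr.
  have := ler_norm K; nra.
split; first by apply/cvg_ex; exists d.
by apply: cvg_lim fd; exact: norm_hausdorff.
Qed.

Lemma is_derive_approx f a d : is_derive a 1 f d -> forall e : R, 0 < e ->
  \forall h \near (0 : C), cabs (f (a + h) - f a - d * h) <= e * cabs h.
Proof.
move=> [fa <-] e e0.
have : nbhs ('D_1 f a) [set t | cabs (t - 'D_1 f a) < e].
  by apply/cnbhsP; exists e.
move=> /fa; rewrite /= nbhs_filterE => /cnbhsP[r r0 rP].
apply/cnbhsP; exists r => // h hr.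
have [->|h0] := eqVneq h 0.
  by rewrite addr0 mulr0 subr0 subrr cabs0 mulr0.
pose D : C := 'D_1 f a; rewrite -/D.
have : cabs (h^-1 * (f (h * 1 + a) - f a) - D) < e by exact: (rP h hr h0).
rewrite mulr1 [h + a]addrC => /ltW.
have -> : h^-1 * (f (a + h) - f a) - D = h^-1 * (f (a + h) - f a - D * h).
  by field.
by rewrite cabsM cabsV ler_pdivrMl ?cabs_gt0 // [_ * e]mulrC.
Qed.

End ComplexAnalysis.

(** * Power series *)

Section PowerSeries.
Variable R : realType.
Local Notation C := (Cplx R).
Implicit Types (a b d h k t l x y : C) (f g : C -> C) (c u : nat -> C).

(** The condition inside [analytic_on] at one point, with the coefficients exposed so that an
    expansion can be shifted, factored and differentiated. *)
Definition has_pseries f a c : Prop :=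
  \forall h \near (0 : C),
    series (fun n => c n * h ^+ n) @ \oo --> f (a + h).

Lemma series_geo_le u (B : R) n :
  (forall i, cabs (u i) <= B / 2 ^+ i) -> cabs (series u n) <= 2 * B.
Proof.
move=> uB; have B0 : 0 <= B.
  by have := uB 0%N; rewrite expr0 divr1; apply: le_trans; exact: cabs_ge0.
(* The induction needs the exact geometric partial sum. *)
suff : cabs (series u n) <= 2 * B - 2 * B / 2 ^+ n.
  have : 0 <= 2 * B / 2 ^+ n by rewrite divr_ge0 ?exprn_ge0 ?mulr_ge0.
  lra.
elim: n => [|n IH].
  by rewrite /series /= big_geq // cabs0 expr0 divr1 subrr.
rewrite seriesSr (le_trans (cabsD _ _)) // (le_trans (lerD IH (uB n))) //.
have E : B / 2 ^+ n = 2 * B / 2 ^+ n.+1.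
  by rewrite exprS invfM [2 * B]mulrC mulrA mulfK ?pnatr_eq0.
rewrite -E; lra.
Qed.

(** Convergence at the single point [r / 2] bounds the terms there by some [M], so [c n] is at most
    [M * (2 / r) ^+ n]; the sum [M + 2 / r] absorbs both constants, whence the exponent [n.+1]. *)
Lemma has_pseries_bound f a c : has_pseries f a c ->
  exists2 A : R, 0 < A & forall n, cabs (c n) <= A ^+ n.+1.
Proof.
move=> /cnbhsP[r r0 rP].
pose h : C := ((r / 2)%:C)%C.
have hE : cabs h = r / 2 by rewrite cabsR gtr0_norm // divr_gt0.
have /rP/ccvgP cf : cabs (h - 0) < r by rewrite subr0 hE; lra.
have [m mP] : exists m, forall n, (m <= n)%N -> cabs (c n * h ^+ n) < 1.
  (* Two consecutive partial sums within [1 / 2] of the limit differ by less than 1. *)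
  have [m mP] := cf (1 / 2) ltac:(lra).
  exists m => n mn.
  have := mP n mn; have := mP n.+1 (leqW mn); rewrite seriesSr.
  set S := series _ _; set T := c n * _; set L := f _ => H1 H2.
  have -> : T = (S + T - L) + (L - S) by ring.
  by rewrite (le_lt_trans (cabsD _ _)) // (cabs_distC L S); lra.
pose M : R := 1 + \sum_(i < m) cabs (c i * h ^+ i).
have MP n : cabs (c n * h ^+ n) <= M.
  have S0 (P : pred 'I_m) : 0 <= \sum_(i < m | P i) cabs (c i * h ^+ i).
    by apply: sumr_ge0 => i _; exact: cabs_ge0.
  have [mn|nm] := leqP m n.
    by rewrite (le_trans (ltW (mP n mn))) // /M lerDl S0.
  by rewrite /M (bigD1 (Ordinal nm)) //= addrCA lerDl addr_ge0 // S0.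
have M0 : 0 < M.
  rewrite /M ltr_pwDl // sumr_ge0 // => i _; exact: cabs_ge0.
clearbody M.
have r20 : 0 < 2 / r by rewrite divr_gt0.
exists (M + 2 / r) => [|n]; first by rewrite addr_gt0.
have := MP n; rewrite cabsM cabsX hE.
have rn : 0 < (r / 2) ^+ n by rewrite exprn_gt0 // divr_gt0.
rewrite -ler_pdivlMr // => /le_trans; apply.
rewrite exprS ler_pM ?(ltW M0) ?invr_ge0 ?(ltW rn) ?lerDl ?(ltW r20) //.
rewrite -exprVn invf_div lerXn2r ?nnegrE ?(ltW r20) ?addr_ge0 ?(ltW M0) ?(ltW r20) //.
by rewrite lerDr ltW.
Qed.

Lemma pseries_term_le c (A : R) h : 0 < A ->
  (forall n, cabs (c n) <= A ^+ n.+1) -> cabs h <= (2 * A)^-1 ->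
  forall n, cabs (c n * h ^+ n) <= A / 2 ^+ n.
Proof.
move=> A0 cA hA n; rewrite cabsM cabsX.
rewrite (le_trans (ler_pM (cabs_ge0 _) _ (cA n) (lerXn2r n _ _ hA))) //
  ?exprn_ge0 ?nnegrE ?cabs_ge0 ?invr_ge0 ?mulr_ge0 ?(ltW A0) //.
by rewrite exprS invfM exprMn -mulrA [A ^+ n * _]mulrCA !exprVn mulfV ?mulr1 // expf_neq0 // gt_eqF.
Qed.

Lemma has_pseries_val f a c : has_pseries f a c -> c 0%N = f a.
Proof.
move=> /nbhs_singleton; rewrite addr0 => cf; apply/esym/(ccvg_unique cf).
apply/ccvgP => e e0; exists 1%N => -[//|n] _.
rewrite /series /= big_nat_recl // expr0 mulr1 big1_seq ?addr0 ?subrr ?cabs0 //.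
by move=> i _; rewrite expr0n mulr0.
Qed.

Lemma has_pseries_bounded f a c : has_pseries f a c ->
  exists B : R, \forall h \near (0 : C), cabs (f (a + h)) <= B.
Proof.
move=> fc; have [A A0 cA] := has_pseries_bound fc; exists (2 * A).
have A20 : 0 < (2 * A)^-1 by rewrite invr_gt0 mulr_gt0.
have : \forall h \near (0 : C), cabs h < (2 * A)^-1.
  by apply/cnbhsP; exists (2 * A)^-1 => // t; rewrite subr0.
apply: filterS2 fc => h cf hA; rewrite -[f _]subr0.
apply: (ccvg_le cf) => n; rewrite subr0; apply: series_geo_le.
exact/pseries_term_le/ltW.
Qed.

(** The difference quotient with its singularity at [a] filled by [d], which will be the derivative
    [c 1]. *)
Definition shift_quot f a (d : C) t : C :=
  if t == a then d else (f t - f a) / (t - a).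

Lemma shift_quotE f a d t : f t = f a + (t - a) * shift_quot f a d t.
Proof.
rewrite /shift_quot; case: eqVneq => [->|ta]; first by rewrite subrr mul0r addr0.
by rewrite mulrC divfK ?subr_eq0 // addrC subrK.
Qed.

(** As [c 0 = f a], removing the constant term and dividing by [h] turns partial sums of [c] into
    partial sums of the shifted coefficients. This gives the quadratic remainder (two shifts), the
    factorisation of zeros, and the removal of the singularity of the Blaschke quotient. *)
Lemma has_pseries_shift f a c : has_pseries f a c ->
  has_pseries (shift_quot f a (c 1%N)) a (fun n => c n.+1).
Proof.
move=> fc; have fa := has_pseries_val fc.
apply: filterS fc => h /ccvgP cf.
have [->|h0] := eqVneq h 0.
  rewrite addr0 /shift_quot eqxx.
  apply/ccvgP => e e0; exists 1%N => -[//|n] _.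
  rewrite /series /= big_nat_recl // expr0 mulr1 big1_seq ?addr0 ?subrr ?cabs0 //.
  by move=> i _; rewrite expr0n mulr0.
have hE : shift_quot f a (c 1%N) (a + h) = (f (a + h) - f a) / h.
  rewrite /shift_quot ifN; last by rewrite -subr_eq0 addrAC subrr add0r.
  by rewrite [a + h - a]addrAC subrr add0r.
have hp : 0 < cabs h by rewrite cabs_gt0.
rewrite hE; apply/ccvgP => e e0.
have [m mP] := cf (e * cabs h) (mulr_gt0 e0 hp).
exists m => n mn; have := mP n.+1 (leqW mn).
rewrite /series /= big_nat_recl // expr0 mulr1 fa.
under eq_bigr do rewrite exprSr mulrA.
rewrite -mulr_suml; set S := \sum_(_ <= _ < _) _ => H.
rewrite -(ltr_pM2r hp) -cabsM mulrBl divfK //.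
by apply: le_lt_trans H; rewrite le_eqVlt; apply/orP; left; apply/eqP; congr cabs; ring.
Qed.

Lemma has_pseries_quad f a c : has_pseries f a c -> exists K : R,
  \forall h \near (0 : C), cabs (f (a + h) - f a - c 1%N * h) <= K * cabs h ^+ 2.
Proof.
move=> fc; have gc := has_pseries_shift fc.
have [K KP] := has_pseries_bounded (has_pseries_shift gc).
exists K; apply: filterS KP => h hK.
rewrite (shift_quotE f a (c 1%N) (a + h)).
rewrite (shift_quotE (shift_quot f a (c 1%N)) a (c 2%N) (a + h)).
have -> : shift_quot f a (c 1%N) a = c 1%N by rewrite /shift_quot eqxx.
set G := shift_quot _ _ _ _ in hK *.
have -> : f a + (a + h - a) * (c 1%N + (a + h - a) * G) - f a - c 1%N * h =
   G * h ^+ 2 by ring.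
by rewrite cabsM cabsX ler_wpM2r // exprn_ge0 // cabs_ge0.
Qed.

Lemma has_pseries_is_derive f a c : has_pseries f a c ->
  is_derive a 1 f (c 1%N).
Proof. by move=> /has_pseries_quad/is_derive_quad. Qed.

Lemma derivable_continuous f a : derivable f a 1 -> {for a, continuous f}.
Proof. by move=> /derivable1_diffP/differentiable_continuous. Qed.

Lemma has_pseries_continuous f a c : has_pseries f a c -> {for a, continuous f}.
Proof. by move=> /has_pseries_is_derive[/derivable_continuous]. Qed.

Lemma has_pseries_factor f a c n : has_pseries f a c ->
  (forall i, (i < n)%N -> c i = 0) ->
  exists v, has_pseries v a (fun i => c (n + i)%N) /\
    forall t, f t = (t - a) ^+ n * v t.
Proof.
move=> fc; elim: n => [_|n IH cn0].
  by exists f; split => // t; rewrite expr0 mul1r.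
have [i ni|v [vc fv]] := IH; first by apply: cn0; rewrite ltnS ltnW.
have va : v a = 0 by rewrite -(has_pseries_val vc) addn0 cn0.
exists (shift_quot v a (c (n + 1)%N)); split.
  have -> : (fun i => c (n.+1 + i)%N) = (fun i => c (n + i.+1)%N).
    by apply/funext => i; rewrite addSnnS.
  exact: has_pseries_shift vc.
by move=> t; rewrite fv (shift_quotE v a (c (n + 1)%N) t) va add0r exprSr mulrA.
Qed.

Lemma has_pseries_zero f a : has_pseries f a (fun=> 0) -> \forall t \near a, f t = 0.
Proof.
move=> f0; apply/cnear_shiftP; apply: filterS f0 => h cf.
apply: (ccvg_unique cf); apply/ccvgP => e e0; exists 0%N => n _.
by rewrite /series /= big1_seq ?subrr ?cabs0 // => i _; rewrite mul0r.
Qed.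

Lemma has_pseriesZ f a c d : has_pseries f a c ->
  has_pseries (fun t => d * f t) a (fun n => d * c n).
Proof.
apply: filterS => h cf.
have -> : series (fun n => d * c n * h ^+ n) =
   (fun n => d * series (fun n => c n * h ^+ n) n).
  apply/funext => n; rewrite /series /= mulr_sumr.
  by apply: eq_bigr => i _; rewrite mulrA.
exact: (cvgM (cvg_cst _) cf).
Qed.

Lemma has_pseriesD f g a c u : has_pseries f a c -> has_pseries g a u ->
  has_pseries (fun t => f t + g t) a (fun n => c n + u n).
Proof.
apply: filterS2 => h cf cg.
have -> : series (fun n => (c n + u n) * h ^+ n) =
   (fun n => series (fun n => c n * h ^+ n) n + series (fun n => u n * h ^+ n) n).
  apply/funext => n; rewrite /series /= -big_split /=.
  by apply: eq_bigr => i _; rewrite mulrDl.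
exact: (cvgD cf cg).
Qed.

Lemma has_pseriesXM f a c : has_pseries f a c ->
  has_pseries (fun t => (t - a) * f t) a (fun n => if n is m.+1 then c m else 0).
Proof.
apply: filterS => h cf; rewrite [a + h - a]addrAC subrr add0r.
have hcf : (fun n => h * series (fun n => c n * h ^+ n) n) @ \oo --> h * f (a + h).
  exact: (cvgM (cvg_cst _) cf).
move/ccvgP in hcf.
apply/ccvgP => e e0; have [m mP] := hcf e e0; exists m.+1 => -[//|n mn].
have -> : series (fun n => (if n is m.+1 then c m else 0) * h ^+ n) n.+1 =
    h * series (fun n => c n * h ^+ n) n.
  rewrite /series /= big_nat_recl // mul0r add0r mulr_sumr.
  by apply: eq_bigr => i _; rewrite exprS mulrCA.
exact: mP.
Qed.

Lemma has_pseries_cst d a :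
  has_pseries (fun=> d) a (fun n => if n is 0%N then d else 0).
Proof.
near=> h; apply/ccvgP => e e0; exists 1%N => -[//|n] _.
rewrite /series /= big_nat_recl // expr0 mulr1 big1_seq ?addr0 ?subrr ?cabs0 //.
by move=> i _; rewrite mul0r.
Unshelve. all: by end_near.
Qed.

End PowerSeries.

(** * Analytic functions *)

Section AnalyticFunctions.
Variable R : realType.
Local Notation C := (Cplx R).
Implicit Types (a b d h k t l x y : C) (f g : C -> C) (c u : nat -> C).
Implicit Types U : set C.

Lemma expr_taylor2_le h k (r : R) n : 0 < r -> cabs h <= r -> cabs (h + k) <= r ->
  r ^+ 2 * cabs ((h + k) ^+ n - h ^+ n - n%:R * h ^+ n.-1 * k)
  <= cabs k ^+ 2 * (2 * r) ^+ n.
Proof.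
move=> r0 hr hkr; elim: n => [|n IH].
  by rewrite !expr0 subrr mul0r mul0r subrr cabs0 mulr0 mulr1 exprn_ge0 ?cabs_ge0.
have -> : (h + k) ^+ n.+1 - h ^+ n.+1 - n.+1%:R * h ^+ n.+1.-1 * k =
    (h + k) * ((h + k) ^+ n - h ^+ n - n%:R * h ^+ n.-1 * k)
    + n%:R * h ^+ n.-1 * k ^+ 2.
  by case: n {IH} => [|n] /=; rewrite ?exprS -?natr1; ring.
rewrite [(2 * r) ^+ n.+1]exprS; set e := cabs (_ - _ - _) in IH *.
rewrite (le_trans (ler_wpM2l _ (cabsD _ _))) ?exprn_ge0 ?(ltW r0) //.
rewrite !cabsM cabs_nat !cabsX -/e.
have H1 : n%:R * cabs h ^+ n.-1 * r <= (2 * r) ^+ n.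
  rewrite exprMn; case: n {IH e} => [|n]; first by rewrite mul0r mul0r expr0 mul1r.
  rewrite -mulrA ler_pM //.
  - by rewrite mulr_ge0 ?exprn_ge0 ?cabs_ge0 ?(ltW r0).
  - by rewrite -natrX ler_nat ltnW // ltn_expl.
  - by rewrite exprSr ler_wpM2r ?(ltW r0) // lerXn2r ?nnegrE ?cabs_ge0 ?(ltW r0).
have k20 : 0 <= cabs k ^+ 2 by rewrite exprn_ge0 // cabs_ge0.
have e0 : 0 <= e by exact: cabs_ge0.
have H2 : cabs (h + k) * (r ^+ 2 * e) <= r * (cabs k ^+ 2 * (2 * r) ^+ n).
  by rewrite ler_pM ?cabs_ge0 // mulr_ge0 // exprn_ge0 // ltW.
have H3 : cabs k ^+ 2 * r * (n%:R * cabs h ^+ n.-1 * r) <= cabs k ^+ 2 * r * (2 * r) ^+ n.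
  by rewrite ler_wpM2l // mulr_ge0 // ltW.
lra.
Qed.

Lemma derivable_is_derive1 f a : derivable f a 1 -> is_derive a 1 f (derive1 f a).
Proof. by move=> fa; exact: (DeriveDef fa (esym (derive1E f a))). Qed.

(** The derivative of [f] at [a + h] exists by assumption, so only the limit of the formal
    derivative has to be identified with it; this is done by comparing both with one difference
    quotient of [f]. *)
Lemma has_pseries_derive1 f a c : has_pseries f a c ->
  (\forall t \near a, derivable f t 1) ->
  has_pseries (derive1 f) a (fun n => n.+1%:R * c n.+1).
Proof.
move=> fc /cnear_shiftP fd; have [A A0 cA] := has_pseries_bound fc.
have /cnbhsP[r r0 rP] : \forall h \near (0 : C), derivable f (a + h) 1 /\
    series (fun n => c n * h ^+ n) @ \oo --> f (a + h).
  by apply: filterS2 fd fc.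
(* Since [2 * q = (2 * A)^-1], the bound [A ^+ i.+1] on [c i] times the Taylor factor
   [(2 * q) ^+ i / q ^+ 2] is [16 * A ^+ 3 / 2 ^+ i], which sums to [K]. *)
pose q : R := (4 * A)^-1.
have q0 : 0 < q by rewrite invr_gt0 mulr_gt0.
apply/cnbhsP; exists (Num.min r q) => [|h]; first by rewrite lt_min r0 q0.
rewrite lt_min subr0 => /andP[hr hq].
have [fh ch] : derivable f (a + h) 1 /\ series (fun n => c n * h ^+ n) @ \oo --> f (a + h).
  by apply: rP; rewrite subr0.
pose d : C := derive1 f (a + h).
have hd : is_derive (a + h) 1 f d by exact: derivable_is_derive1.
pose K : R := 2 * (16 * A ^+ 3).
have K0 : 0 < K by rewrite mulr_gt0 // mulr_gt0 // exprn_gt0.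
have KP k n : cabs (h + k) <= q -> cabs (series (fun n => c n *
    ((h + k) ^+ n - h ^+ n - n%:R * h ^+ n.-1 * k)) n) <= K * cabs k ^+ 2.
  move=> hkq; rewrite /K -mulrA; apply: series_geo_le => i; rewrite cabsM.
  have /= H := expr_taylor2_le i q0 (ltW hq) hkq.
  have q20 : 0 < q ^+ 2 by rewrite exprn_gt0.
  rewrite mulrC in H; rewrite -ler_pdivlMr // in H.
  rewrite (le_trans (ler_pM (cabs_ge0 _) (cabs_ge0 _) (cA i) H)) //.
  have -> : 2 * q = (2 * A)^-1 by rewrite /q; field; rewrite gt_eqF.
  rewrite exprVn exprMn /q le_eqVlt; apply/orP; left; apply/eqP.
  rewrite exprS; field.
  by rewrite !expf_neq0 // gt_eqF.
apply/ccvgP => e e0.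
have e80 : 0 < e / 8 by rewrite divr_gt0.
have /cnbhsP[s s0 sP] := is_derive_approx hd e80.
(* The increment [k] is fixed before [n]. The Taylor remainder, the two partial sums and the
   difference quotient of [f] each cost at most [e / 8 * cabs k]. *)
pose m := Num.min (Num.min s (r - cabs h)) (Num.min (q - cabs h) (e / 8 / K)).
have m0 : 0 < m by rewrite /m !lt_min s0 !subr_gt0 hr hq divr_gt0.
pose k : C := ((m / 2)%:C)%C.
have km : cabs k = m / 2 by rewrite cabsR gtr0_norm // divr_gt0.
have kk : cabs k < m by rewrite km; lra.
have k0 : 0 < cabs k by rewrite km divr_gt0.
have := kk; rewrite /m !lt_min => /andP[/andP[ks kr] /andP[kq kK]].
have hkD := cabsD h k.
have [_ chk] : derivable f (a + (h + k)) 1 /\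
    series (fun n => c n * (h + k) ^+ n) @ \oo --> f (a + (h + k)).
  by apply: rP; rewrite subr0; lra.
have /KP KPk : cabs (h + k) <= q by lra.
have ek0 : 0 < e / 8 * cabs k by rewrite mulr_gt0.
move: ch chk => /ccvgP/(_ _ ek0)[n1 P1] /ccvgP/(_ _ ek0)[n2 P2].
exists (maxn n1 n2) => n; rewrite geq_max => /andP[nn1 nn2].
have := P1 _ (leqW nn1); have := P2 _ (leqW nn2); have := KPk n.+1.
have := sP k; rewrite subr0 => /(_ ks).
have -> : series (fun n => c n * ((h + k) ^+ n - h ^+ n - n%:R * h ^+ n.-1 * k)) n.+1 =
   series (fun n => c n * (h + k) ^+ n) n.+1 - series (fun n => c n * h ^+ n) n.+1
   - series (fun n => n.+1%:R * c n.+1 * h ^+ n) n * k.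
  rewrite /series /=.
  under eq_bigr do rewrite !mulrBr.
  rewrite !sumrB; congr (_ - _).
  rewrite big_nat_recl // mul0r mul0r mulr0 add0r mulr_suml.
  by apply: eq_bigr => i _ /=; rewrite !mulrA [c _ * _]mulrC.
rewrite -[a + h + k]addrA -/d.
set S1 := series _ n.+1; set S2 := series _ n.+1; set S := series _ n.
set F1 := f _; set F2 := f _ => H1 H2 H3 H4.
rewrite -(ltr_pM2r k0) -cabsM.
have -> : (S - d) * k = - (S1 - S2 - S * k) + (S1 - F1) - (S2 - F2) + (F1 - F2 - d * k).
  by ring.
have := cabsD (- (S1 - S2 - S * k) + (S1 - F1) - (S2 - F2)) (F1 - F2 - d * k).
have := cabsD (- (S1 - S2 - S * k) + (S1 - F1)) (- (S2 - F2)).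
have := cabsD (- (S1 - S2 - S * k)) (S1 - F1).
rewrite !(cabsN (S1 - S2 - S * k)) !(cabsN (S2 - F2)).
have : K * cabs k ^+ 2 <= e / 8 * cabs k.
  rewrite expr2 mulrA ler_wpM2r ?(ltW k0) // mulrC -ler_pdivlMr //; exact: ltW.
lra.
Qed.

Lemma open_nearW U a (P : C -> Prop) : open U -> U a -> (forall t, U t -> P t) ->
  \forall t \near a, P t.
Proof.
by move=> Uo Ua UP; apply: filterS (open_nbhs_nbhs (conj Uo Ua)).
Qed.

Lemma analytic_on_derivable U f a : analytic_on U f -> U a -> derivable f a 1.
Proof. by move=> fU /fU[c /has_pseries_is_derive[]]. Qed.

Lemma analytic_on_derive1 U f : open U -> analytic_on U f -> analytic_on U (derive1 f).
Proof.
move=> Uo fU a Ua; have [c fc] := fU a Ua.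
have fd : \forall t \near a, derivable f t 1.
  by apply: (open_nearW Uo Ua) => t; exact: analytic_on_derivable fU.
exists (fun n => n.+1%:R * c n.+1); exact: (has_pseries_derive1 fc fd).
Qed.

Lemma analytic_on_is_derive U f n a : open U -> analytic_on U f -> U a ->
  is_derive a 1 (derive1n n f) (derive1n n.+1 f a).
Proof.
move=> Uo fU Ua; rewrite derive1nS; apply: derivable_is_derive1.
apply: (analytic_on_derivable _ Ua).
by elim: n => [//|n IH]; rewrite derive1nS; exact: analytic_on_derive1.
Qed.

(* If [Q] does not vanish near [a], then [g = mu (1 + C (t - a)^n (1 + o(1)))],
   and [|g|] exceeds [|mu|] along a ray on which [C (t - a)^n] is positive. *)
Lemma pseries_local_max (Q E : C -> C) g a c mu :
  has_pseries Q a c -> Q a = 0 -> {for a, continuous E} -> E a != 0 ->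
  (\forall t \near a, g t = mu + Q t * E t) ->
  (\forall t \near a, cabs (g t) <= cabs mu) ->
  \forall t \near a, Q t = 0.
Proof.
(* If [mu = 0], then [g] vanishes near [a], and so does [Q] because [E] does not. *)
move=> Qc Qa cE Ea gE gmu; have [mu0|mu0] := eqVneq mu 0.
  have Ea0 : 0 < cabs (E a) by rewrite cabs_gt0.
  have [r r0 rP] := (ccontP E a).1 cE _ Ea0.
  have nE : \forall t \near a, cabs (E t - E a) < cabs (E a) by apply/cnbhsP; exists r.
  apply: filterS3 gE gmu nE => t gtE; rewrite mu0 cabs0 => gt0 Et.
  have : g t == 0 by rewrite -cabs_eq0 eq_le gt0 cabs_ge0.
  rewrite gtE mu0 add0r mulf_eq0 => /orP[/eqP //|/eqP Et0].
  by move: Et; rewrite Et0 sub0r cabsN ltxx.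
have [c0|] := pselect (forall n, c n = 0).
  apply: has_pseries_zero; apply: filterS Qc => h.
  by under eq_fun do rewrite c0.
move=> /existsNP[n0 /eqP cn0].
have [n cn nmin] := ex_minnP (ex_intro (fun n => c n != 0) n0 cn0).
have n_gt0 : (0 < n)%N.
  by rewrite lt0n; apply: contraNneq cn => ->; rewrite (has_pseries_val Qc) Qa.
have [i ni|v [vc Qv]] := has_pseries_factor (n := n) Qc.
  by apply/eqP; apply: contraLR ni => ci; rewrite -leqNgt nmin.
have va : v a != 0 by rewrite -(has_pseries_val vc) addn0.
pose F t : C := v t * E t.
have Fa : F a != 0 by rewrite mulf_neq0.
have cF : {for a, continuous F} by exact: (cvgM (has_pseries_continuous vc) cE).
have Fa2 : 0 < cabs (F a) / 2 by rewrite divr_gt0 // cabs_gt0.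
have [r1 r10 r1P] := (ccontP F a).1 cF _ Fa2.
have nF : \forall t \near a, cabs (F t - F a) < cabs (F a) / 2 by apply/cnbhsP; exists r1.
have /cnbhsP[r r0 rP] : \forall t \near a, [/\ g t = mu + Q t * E t,
    cabs (g t) <= cabs mu & cabs (F t - F a) < cabs (F a) / 2].
  by apply: filterS3 gE gmu nF.
(* The direction in which the leading term points along [mu]: [(z * s) ^+ n * F a = mu * s ^+ n].
   Replacing [F a] by [F t] then costs less than half of this gain. *)
pose z : C := n.-root (mu / F a).
have zn : z ^+ n = mu / F a by rewrite rootCK.
pose s : R := r / (2 * (cabs z + 1)).
have z1 : 0 < cabs z + 1 by rewrite ltr_wpDl // cabs_ge0.
have s0 : 0 < s by rewrite divr_gt0 // mulr_gt0.
have [|gE' gmu' nF'] := rP (a + z * (s%:C)%C).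
  rewrite addrAC subrr add0r cabsM cabsR gtr0_norm //.
  have : (cabs z + 1) * s = r / 2.
    by rewrite /s; field; rewrite gt_eqF.
  by lra.
exfalso; move: gmu'; rewrite gE' Qv.
set t := a + _ in nF' *.
have ta : t - a = z * (s%:C)%C by rewrite /t addrAC subrr add0r.
pose sn : C := ((s ^+ n)%:C)%C; pose s1 : C := ((1 + s ^+ n)%:C)%C.
have -> : mu + (t - a) ^+ n * v t * E t = mu * (s1 + sn * ((F t - F a) / F a)).
  have alg (m w p q : C) : p != 0 ->
      m + m / p * w * q = m * (1 + w + w * ((q - p) / p)).
    by move=> p0; field.
  have sE : sn = (s%:C)%C ^+ n by rewrite /sn rmorphXn.
  have s1E : s1 = 1 + (s%:C)%C ^+ n by rewrite -sE /s1 rmorphD rmorph1.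
  by rewrite sE s1E ta exprMn zn -mulrA; exact: alg.
apply/negP; rewrite -ltNge cabsM ltr_pMr ?cabs_gt0 //.
have sn0 : 0 < s ^+ n by rewrite exprn_gt0.
have cs1 : cabs s1 = 1 + s ^+ n by rewrite cabsR gtr0_norm // addr_gt0.
have csn : cabs sn = s ^+ n by rewrite cabsR gtr0_norm.
clearbody s1 sn.
have := cabs_le_dist s1 (s1 + sn * ((F t - F a) / F a)).
rewrite opprD addNKr cabsN cabsM cs1 csn cabsM cabsV.
have : s ^+ n * (cabs (F t - F a) / cabs (F a)) < s ^+ n.
  rewrite gtr_pMr // ltr_pdivrMr ?cabs_gt0 // mul1r.
  have := cabs_ge0 (F a); lra.
lra.
Qed.

End AnalyticFunctions.

(** * Maximum modulus on a closed disc *)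

Section DiscMaximum.
Variable R : realType.
Local Notation C := (Cplx R).
Implicit Types (a b d h k t x y : C) (f g : C -> C).

Lemma ccontRP (G : C -> R) a :
  (forall e : R, 0 < e -> exists2 r : R, 0 < r &
     forall t, cabs (t - a) < r -> `|G t - G a| < e) -> {for a, continuous G}.
Proof.
move=> Ga A /nbhs_ballP[e /= e0 eA]; have [r r0 rP] := Ga e e0.
apply/cnbhsP; exists r => // t /rP tG; apply: eA.
by rewrite -ball_normE /ball_ /= distrC.
Qed.

Lemma cabs_dist_le x y : `|cabs x - cabs y| <= cabs (x - y).
Proof.
have := cabs_le_dist x y; have := cabs_le_dist y x; rewrite (cabs_distC y x).
by move=> H1 H2; rewrite ler_norml; apply/andP; split; lra.
Qed.

Lemma cabs_continuous a : {for a, continuous (@cabs R)}.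
Proof.
apply: ccontRP => e e0; exists e => // t; exact/le_lt_trans/cabs_dist_le.
Qed.

Lemma cabs_comp_continuous f a : {for a, continuous f} ->
  {for a, continuous (fun t => cabs (f t))}.
Proof.
move=> /ccontP fa; apply: ccontRP => e e0; have [r r0 rP] := fa e e0.
by exists r => // t /rP; exact/le_lt_trans/cabs_dist_le.
Qed.

Definition cdisc (r : R) : set C := [set t | cabs t <= r].

(** A closed subset of the image of a compact real square under the continuous map [psi]. *)
Lemma cdisc_compact (r : R) : compact (cdisc r).
Proof.
pose psi (p : R * R) : C := (p.1 +i* p.2)%C.
have psiP (p q : R * R) : cabs (psi p - psi q) <= `|p.1 - q.1| + `|p.2 - q.2|.
  have -> : psi p - psi q = ((p.1 - q.1) +i* 0)%C + (0 +i* (p.2 - q.2))%C :> C.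
    by apply/eqP; rewrite eq_complex /= addr0 add0r !eqxx.
  rewrite (le_trans (cabsD _ _)) // /cabs /= !expr0n /= addr0 add0r.
  by rewrite !sqrtr_sqr.
have psi_cont : continuous psi.
  move=> p A /cnbhsP[e e0 eA].
  have e2 : 0 < e / 2 by rewrite divr_gt0.
  exists (ball p.1 (e / 2), ball p.2 (e / 2)) => /=.
    by split; exact: nbhsx_ballx.
  move=> q [/= q1 q2]; apply: eA; apply: le_lt_trans (psiP q p) _.
  move: q1 q2; rewrite -!ball_normE /ball_ /= ![`|_ - (q : R * R).1|]distrC.
  rewrite ![`|_ - (q : R * R).2|]distrC; lra.
have sq : compact (`[- r, r]%classic `*` `[- r, r]%classic : set (R * R)).
  by apply: compact_setX; exact: segment_compact.
apply: (subclosed_compact _ (continuous_compact (continuous_subspaceT psi_cont) sq)).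
  apply: (closed_comp (f := @cabs R) (D := [set s : R | s <= r])).
    by move=> t _; exact: cabs_continuous.
  exact: closed_le.
move=> t tr; exists (complex.Re t, complex.Im t) => /=; last by case: t {tr}.
have H (s1 s2 : R) : Num.sqrt (s1 ^+ 2 + s2 ^+ 2) <= r -> - r <= s1 <= r.
  move=> sr; rewrite -ler_norml -sqrtr_sqr; apply: le_trans sr.
  by rewrite ler_wsqrtr // lerDl sqr_ge0.
case: t tr => u v uv; rewrite /= !in_itv /=; split; first exact: (H u v).
by apply: (H v u); rewrite addrC.
Qed.

(* Among the points of the closed disc where [|g|] is maximal, take one of
   largest modulus: where [g] is locally constant, it must be on the boundary. *)
Lemma cdisc_outermost_max g (r : R) : 0 <= r ->
  (forall t, cabs t <= r -> {for t, continuous g}) ->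
  exists p, [/\ cabs p <= r, (forall t, cabs t <= r -> cabs (g t) <= cabs (g p)) &
    (forall t, cabs t <= r -> cabs (g t) = cabs (g p) -> cabs t <= cabs p)].
Proof.
move=> r0 gc.
have [||q qr qmax] := @compact_EVT_max C R (fun t => cabs (g t)) (cdisc r) _ (@cdisc_compact r).
- by exists (0 : C); change (cabs (0 : C) <= r); rewrite cabs0.
- apply: continuous_in_subspaceT => t; rewrite inE => tr.
  exact/cabs_comp_continuous/gc.
have {}qr : cabs q <= r by move: qr; rewrite inE.
have {}qmax t : cabs t <= r -> cabs (g t) <= cabs (g q).
  by move=> tr; apply: qmax; rewrite inE.
(* The maximum points of [|g|]. Continuity of [g] is known only at points of the closed disc, so the
   complement is shown open in two cases. *)
pose K : set C := [set t | cabs t <= r /\ cabs (g q) <= cabs (g t)].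
have cK : compact K.
  apply: (subclosed_compact _ (@cdisc_compact r)) => [|t []//].
  rewrite -[K]setCK; apply: open_closedC; rewrite openE => t nKt.
  have [tr|rt] := leP (cabs t) r.
    have gt : cabs (g t) < cabs (g q).
      by rewrite ltNge; apply/negP => gqt; apply: nKt.
    have e0 : 0 < cabs (g q) - cabs (g t) by rewrite subr_gt0.
    have [s s0 sP] := (ccontP g t).1 (gc t tr) _ e0.
    apply/cnbhsP; exists s => // x /sP xt [_].
    have := cabs_le_dist (g x) (g t); lra.
  apply/cnbhsP; exists (cabs t - r); first by rewrite subr_gt0.
  move=> x xt [xr _]; have := cabs_le_dist t x; rewrite (cabs_distC t x); lra.
have [||p pK pmax] := @compact_EVT_max C R (@cabs R) K _ cK.
- by exists q.
- by apply: continuous_in_subspaceT => t _; exact: cabs_continuous.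
move: pK; rewrite inE => -[pr qp].
exists p; split=> // [t tr|t tr gtp]; first exact: le_trans (qmax t tr) qp.
by apply: pmax; rewrite inE; split=> //; rewrite gtp.
Qed.

End DiscMaximum.

(** * The Schwarz-Pick inequality *)

Section SchwarzPick.
Variable R : realType.
Local Notation C := (Cplx R).
Implicit Types (a b d h k t x y mu : C) (f g : C -> C).

Definition analytic_at f a : Prop := exists c, has_pseries f a c.

Lemma analytic_at_cst d a : analytic_at (fun=> d) a.
Proof. by eexists; exact: has_pseries_cst. Qed.

Lemma analytic_atD f g a : analytic_at f a -> analytic_at g a ->
  analytic_at (fun t => f t + g t) a.
Proof. by move=> [c fc] [u gu]; eexists; exact: has_pseriesD fc gu. Qed.

Lemma analytic_atZ d f a : analytic_at f a -> analytic_at (fun t => d * f t) a.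
Proof. by move=> [c fc]; eexists; exact: has_pseriesZ fc. Qed.

(** Multiplication by [t - a] only shifts coefficients, so affine factors, the only non-constant
    ones used below, need no Cauchy product. *)
Lemma analytic_at_affM d b f a : analytic_at f a ->
  analytic_at (fun t => (d + b * t) * f t) a.
Proof.
move=> fa; have -> : (fun t => (d + b * t) * f t) =
    (fun t => b * ((t - a) * f t) + (d + b * a) * f t).
  by apply/funext => t; ring.
have xf : analytic_at (fun t => (t - a) * f t) a.
  by case: fa => c fc; eexists; exact: has_pseriesXM fc.
exact: (analytic_atD (analytic_atZ b xf) (analytic_atZ _ fa)).
Qed.

Lemma continuous_affine d b a : {for a, continuous (fun t => d + b * t)}.
Proof.
have [c] := analytic_at_affM d b (analytic_at_cst 1 a).
by under eq_fun do rewrite mulr1; exact: has_pseries_continuous.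
Qed.

Lemma near_eq_continuous f g a : (\forall t \near a, f t = g t) ->
  {for a, continuous f} -> {for a, continuous g}.
Proof.
move=> fg fa A; rewrite -(nbhs_singleton fg) => /fa fA.
by apply: filterS2 fg fA => t /= <-.
Qed.

Lemma unit_discE t : unit_disc t <-> cabs t < 1.
Proof.
rewrite /unit_disc /= normcE -[1 : C]/((1 : R)%:C)%C.
by split; [rewrite ltcR|move=> ?; rewrite ltcR].
Qed.

Lemma near_lt_cabs a (r : R) : cabs a < r -> \forall t \near a, cabs t < r.
Proof.
move=> ar; apply/cnbhsP; exists (r - cabs a); first by rewrite subr_gt0.
by move=> t ta; have := cabs_le_dist t a; lra.
Qed.

Lemma unit_disc_open : open (@unit_disc R).
Proof.
by rewrite openE => a /unit_discE/near_lt_cabs; apply: filterS => t /unit_discE.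
Qed.

Lemma near_neq a b : a != b -> \forall t \near a, t != b.
Proof.
move=> ab; apply/cnbhsP; exists (cabs (a - b)); first by rewrite cabs_gt0 subr_eq0.
by move=> t ta; apply/eqP => tb; move: ta; rewrite tb cabs_distC ltxx.
Qed.

(* The disc automorphism sending [b] to [0] is
   [t |-> (t - b) / blaschke_den b t]. *)
Definition blaschke_den b t : C := 1 + - b^* * t.

(** The last term is positive inside the disc, which bounds the Blaschke factor by 1, and it tends
    to 0 at the boundary, where that factor is nearly unimodular. *)
Lemma blaschke_identity b t : cabs (blaschke_den b t) ^+ 2 =
  cabs (t - b) ^+ 2 + (1 - cabs b ^+ 2) * (1 - cabs t ^+ 2).
Proof.
have sqE (u v : R) : cabs ((u +i* v)%C : C) ^+ 2 = u ^+ 2 + v ^+ 2.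
  by rewrite /cabs /= sqr_sqrtr // addr_ge0 ?sqr_ge0.
case: b => b1 b2; case: t => t1 t2.
have -> : blaschke_den ((b1 +i* b2)%C : C) (t1 +i* t2)%C =
   ((1 - (b1 * t1 + b2 * t2)) +i* (b2 * t1 - b1 * t2))%C :> C.
  by apply/eqP; rewrite eq_complex /=; apply/andP; split; apply/eqP; ring.
have -> : ((t1 +i* t2)%C - (b1 +i* b2)%C : C) = ((t1 - b1) +i* (t2 - b2))%C :> C.
  by apply/eqP; rewrite eq_complex /= !eqxx.
by rewrite !sqE; ring.
Qed.

Lemma blaschke_lt b t : cabs b < 1 -> cabs t < 1 ->
  cabs (t - b) < cabs (blaschke_den b t).
Proof.
move=> b1 t1; rewrite -(ltr_pXn2r (n := 2)) ?nnegrE ?cabs_ge0 // blaschke_identity.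
have ? := cabs_ge0 b; have ? := cabs_ge0 t.
by rewrite ltrDl mulr_gt0 // subr_gt0 expr_lt1.
Qed.

Lemma blaschke_den_neq0 b t : cabs b < 1 -> cabs t < 1 -> blaschke_den b t != 0.
Proof.
by move=> b1 t1; rewrite -cabs_gt0 (le_lt_trans (cabs_ge0 _) (blaschke_lt b1 t1)).
Qed.

(** * The Blaschke quotient of a self-map of the disc *)

Section Quotient.
Variables (f : C -> C) (b d : C).
Hypothesis f_analytic : forall t, cabs t < 1 -> analytic_at f t.
Hypothesis f_disc : forall t, cabs t < 1 -> cabs (f t) < 1.
Hypothesis b_disc : cabs b < 1.
Hypothesis Sb_analytic : analytic_at (shift_quot f b d) b.

(** The Blaschke factor of [f t] at [f b] divided by that of [t] at [b]; the zero of the latter at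
    [b] is already divided out in [shift_quot]. *)
Definition blaschke_quot t : C :=
  shift_quot f b d t * (blaschke_den b t / blaschke_den (f b) (f t)).

Let fb_disc : cabs (f b) < 1. Proof. exact: f_disc. Qed.

Lemma blaschke_quotE t : t != b -> blaschke_quot t =
  (f t - f b) / (t - b) * (blaschke_den b t / blaschke_den (f b) (f t)).
Proof. by move=> tb; rewrite /blaschke_quot /shift_quot ifN. Qed.

Lemma den_continuous t : cabs t < 1 ->
  {for t, continuous (fun t => blaschke_den (f b) (f t))}.
Proof.
move=> /f_analytic[c /has_pseries_continuous ft].
exact: (cvgD (cvg_cst _) (cvgM (cvg_cst _) ft)).
Qed.

Lemma den_neq0 t : cabs t < 1 -> blaschke_den (f b) (f t) != 0.
Proof. by move=> t1; apply: blaschke_den_neq0 => //; exact: f_disc. Qed.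

Lemma blaschke_quot_continuous t : cabs t < 1 -> {for t, continuous blaschke_quot}.
Proof.
move=> t1.
have cS : {for t, continuous (shift_quot f b d)}.
  have [->|tb] := eqVneq t b.
    by case: Sb_analytic => c /has_pseries_continuous.
  apply: (@near_eq_continuous (fun s => (f s - f b) / (- b + 1 * s))).
    apply: filterS (near_neq tb) => s sb.
    by rewrite /shift_quot ifN // mul1r [- b + s]addrC.
  have [c /has_pseries_continuous ft] := f_analytic t1.
  have tb0 : - b + 1 * t != 0 by rewrite mul1r addrC subr_eq0.
  exact: (cvgM (cvgB ft (cvg_cst _)) (cvgV tb0 (@continuous_affine (- b) 1 t))).
have cD : {for t, continuous (blaschke_den b)} by exact: continuous_affine.
exact: (cvgM cS (cvgM cD (cvgV (den_neq0 t1) (den_continuous t1)))).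
Qed.

(** The quotient minus [mu] is [Q * E], where [Q] is its numerator minus [mu] times its denominator,
    analytic at [p], and [E] is the inverse of the denominator, continuous and nonzero there. For
    [p != b] the denominator contains [t - b]; for [p = b] that factor has been divided out. *)
Lemma blaschke_quot_local_max p : cabs p < 1 ->
  (\forall t \near p, cabs (blaschke_quot t) <= cabs (blaschke_quot p)) ->
  \forall t \near p, blaschke_quot t = blaschke_quot p.
Proof.
move=> p1 pmax; set mu := blaschke_quot p in pmax *.
have near1 := near_lt_cabs p1.
have fp := f_analytic p1.
have den_an : analytic_at (fun t => blaschke_den (f b) (f t)) p.
  exact: (analytic_atD (analytic_at_cst 1 p) (analytic_atZ _ fp)).
have cV : {for p, continuous (fun t => (blaschke_den (f b) (f t))^-1)}.
  exact: (cvgV (den_neq0 p1) (den_continuous p1)).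
have [pb|pb] := eqVneq p b.
  pose Q t := (1 + - b^* * t) * shift_quot f b d t
              + - mu * blaschke_den (f b) (f t).
  have [c Qc] : analytic_at Q p.
    have Sp : analytic_at (shift_quot f b d) p by rewrite pb.
    exact: (analytic_atD (analytic_at_affM _ _ Sp) (analytic_atZ _ den_an)).
  have gE t : cabs t < 1 -> blaschke_quot t = mu + Q t * (blaschke_den (f b) (f t))^-1.
    move=> t1; rewrite /Q /blaschke_quot -/(blaschke_den b t).
    by move: (den_neq0 t1); set D := blaschke_den (f b) (f t) => D0; field.
  have Qp : Q p = 0.
    have /eqP := gE p p1; rewrite -/mu -subr_eq0 opprD addNKr oppr_eq0 mulf_eq0.
    by rewrite invr_eq0 (negPf (den_neq0 p1)) orbF => /eqP.
  have Ep : (blaschke_den (f b) (f p))^-1 != 0 by rewrite invr_eq0 den_neq0.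
  have gE' : \forall t \near p, blaschke_quot t = mu + Q t * (blaschke_den (f b) (f t))^-1.
    by apply: filterS near1 => t; exact: gE.
  have Q0 := pseries_local_max Qc Qp cV Ep gE' pmax.
  by apply: filterS2 gE' Q0 => t -> ->; rewrite mul0r addr0.
pose Q t := (1 + - b^* * t) * (f t + - f b)
            + - mu * ((- b + 1 * t) * blaschke_den (f b) (f t)).
have [c Qc] : analytic_at Q p.
  have fbp := analytic_atD fp (analytic_at_cst (- f b) p).
  exact: (analytic_atD (analytic_at_affM _ _ fbp)
                       (analytic_atZ _ (analytic_at_affM _ _ den_an))).
pose E t := (blaschke_den (f b) (f t))^-1 * (- b + 1 * t)^-1.
have pb0 : - b + 1 * p != 0 by rewrite mul1r addrC subr_eq0.
have gE t : cabs t < 1 -> t != b -> blaschke_quot t = mu + Q t * E t.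
  move=> t1 tb; rewrite blaschke_quotE // /Q /E -/(blaschke_den b t).
  move: (den_neq0 t1); set D := blaschke_den (f b) (f t) => D0.
  have tb1 : t - b != 0 by rewrite subr_eq0.
  have -> : - b + 1 * t = t - b by ring.
  by field; rewrite ?D0 ?tb1.
have cE : {for p, continuous E}.
  exact: (cvgM cV (cvgV pb0 (@continuous_affine (- b) 1 p))).
have Ep : E p != 0 by rewrite mulf_neq0 ?invr_eq0 // den_neq0.
have Qp : Q p = 0.
  have /eqP := gE p p1 pb; rewrite -/mu -subr_eq0 opprD addNKr oppr_eq0 mulf_eq0.
  by rewrite (negPf Ep) orbF => /eqP.
have gE' : \forall t \near p, blaschke_quot t = mu + Q t * E t.
  by apply: filterS2 near1 (near_neq pb) => t; exact: gE.
have Q0 := pseries_local_max Qc Qp cE Ep gE' pmax.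
by apply: filterS2 gE' Q0 => t -> ->; rewrite mul0r addr0.
Qed.

Lemma blaschke_quot_le1 t : cabs t < 1 -> cabs (blaschke_quot t) <= 1.
Proof.
move=> t1; rewrite leNgt; apply/negP => m1.
have [m mE] : exists m, m = cabs (blaschke_quot t) by exists (cabs (blaschke_quot t)).
rewrite -mE in m1.
have bd := b_disc; have b0 := cabs_ge0 b; have t0 := cabs_ge0 t.
(* Chosen so that [2 * e = (m ^+ 2 - 1) * ((1 - cabs b) / 2) ^+ 2]: on a circle of radius at least
   [1 - e], the last term of [blaschke_identity] is then at most
   [(m ^+ 2 - 1) * cabs (p - b) ^+ 2]. *)
have [e e0 eE] : exists2 e : R, 0 < e & e = (m ^+ 2 - 1) * (1 - cabs b) ^+ 2 / 8.
  eexists; last by []; rewrite divr_gt0 // mulr_gt0 ?exprn_gt0 ?subr_gt0 //.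
  by rewrite exprn_egt1.
(* The three bounds put [t] in the closed disc, keep its circle at distance at least
   [(1 - cabs b) / 2] from [b], and bring the circle close to the unit one. *)
pose r := Num.max (Num.max (cabs t) ((1 + cabs b) / 2)) (1 - e).
have r1 : r < 1 by rewrite !gt_max t1 /=; apply/andP; split; lra.
have tr : cabs t <= r by rewrite !le_max lexx.
have br : (1 + cabs b) / 2 <= r by rewrite !le_max lexx orbT.
have er : 1 - e <= r by rewrite !le_max lexx orbT.
clearbody r; have r0 : 0 < r by lra.
have gc s : cabs s <= r -> {for s, continuous blaschke_quot}.
  by move=> sr; apply: blaschke_quot_continuous; exact: le_lt_trans sr r1.
have [p [pr pmax pout]] := cdisc_outermost_max (ltW r0) gc.
have mp : m <= cabs (blaschke_quot p) by rewrite mE; exact: pmax.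
have p1 : cabs p < 1 by exact: le_lt_trans pr r1.
(* On the circle the quotient stays below [m]: the Blaschke factor of [f p] is less than 1 and the
   inverse of that of [p] is at most [m]. *)
have plt : cabs p < r.
  rewrite lt_neqAle pr andbT; apply/eqP => pE.
  have pb : p != b by apply/eqP => pb; move: br; rewrite -pE pb; lra.
  have pb0 : 0 < cabs (p - b) by rewrite cabs_gt0 subr_eq0.
  have D0 := den_neq0 p1; rewrite -cabs_gt0 in D0.
  have Dle : cabs (blaschke_den b p) <= m * cabs (p - b).
    have m0 : 0 <= m by rewrite mE cabs_ge0.
    rewrite -(ler_pXn2r (n := 2)) ?nnegrE ?mulr_ge0 ?cabs_ge0 //.
    rewrite blaschke_identity exprMn pE.
    have dpb : (1 - cabs b) / 2 <= cabs (p - b).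
      by have := cabs_le_dist p b; rewrite pE; lra.
    have dpb2 : ((1 - cabs b) / 2) ^+ 2 <= cabs (p - b) ^+ 2.
      by rewrite ler_pXn2r ?nnegrE ?cabs_ge0 // divr_ge0 // subr_ge0 ltW.
    have m21 : 0 < m ^+ 2 - 1 by rewrite subr_gt0 exprn_egt1.
    have H1 : (m ^+ 2 - 1) * ((1 - cabs b) / 2) ^+ 2 <= (m ^+ 2 - 1) * cabs (p - b) ^+ 2.
      by rewrite ler_pM2l.
    have H2 : 1 - r ^+ 2 <= 2 * e.
      have : (1 - r) * (1 + r) <= e * 2 by rewrite ler_pM //; lra.
      lra.
    have H3 : (1 - cabs b ^+ 2) * (1 - r ^+ 2) <= 1 - r ^+ 2.
      have : 0 <= cabs b ^+ 2 * (1 - r ^+ 2).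
        by rewrite mulr_ge0 ?exprn_ge0 // subr_ge0 expr_le1 // ltW.
      lra.
    have H4 : (m ^+ 2 - 1) * ((1 - cabs b) / 2) ^+ 2 = 2 * e by rewrite eE; field.
    lra.
  suff : cabs (blaschke_quot p) < m by rewrite ltNge mp.
  rewrite blaschke_quotE //.
  rewrite !cabsM !cabsV mulrA ltr_pdivrMr // mulrAC ltr_pdivrMr //.
  have Nlt : cabs (f p - f b) < cabs (blaschke_den (f b) (f p)).
    by apply: blaschke_lt => //; exact: f_disc.
  have D1 : 0 < cabs (blaschke_den b p) by rewrite cabs_gt0 blaschke_den_neq0.
  have : cabs (f p - f b) * cabs (blaschke_den b p)
     < cabs (blaschke_den (f b) (f p)) * cabs (blaschke_den b p) by rewrite ltr_pM2r.
  have : cabs (blaschke_den (f b) (f p)) * cabs (blaschke_den b p)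
     <= cabs (blaschke_den (f b) (f p)) * (m * cabs (p - b)).
    exact: (ler_wpM2l (cabs_ge0 _) Dle).
  lra.
have nmax : \forall s \near p, cabs (blaschke_quot s) <= cabs (blaschke_quot p).
  by apply: filterS (near_lt_cabs plt) => s /ltW; exact: pmax.
have /cnbhsP[s s0 sP] : \forall x \near p,
    cabs x < r /\ blaschke_quot x = blaschke_quot p.
  exact: (filterI (near_lt_cabs plt) (blaschke_quot_local_max p1 nmax)).
(* The outward radial direction, arbitrary when [p = 0]. The point [p + s / 2 * v] has a larger
   modulus and the same value of the quotient, against the choice of [p]. *)
pose v : C := if p == 0 then 1 else p / ((cabs p)%:C)%C.
have cp0 : p != 0 -> ((cabs p)%:C)%C != 0 :> C.
  by move=> p0; rewrite -cabs_eq0 cabsR normr_eq0 cabs_eq0.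
have v1 : cabs v = 1.
  rewrite /v; case: eqVneq => [_|p0]; first exact: cabs1.
  by rewrite cabsM cabsV cabsR ger0_norm ?cabs_ge0 // mulfV // cabs_eq0.
have vp : p + ((s / 2)%:C)%C * v = ((cabs p + s / 2)%:C)%C * v.
  rewrite rmorphD mulrDl; congr (_ + _); rewrite /v.
  by case: eqVneq => [->|p0]; rewrite ?cabs0 ?mul0r // mulrC divfK // cp0.
have [|xr gx] := sP (p + ((s / 2)%:C)%C * v).
  by rewrite addrAC subrr add0r cabsM v1 mulr1 cabsR gtr0_norm ?divr_gt0 //; lra.
have := pout _ (ltW xr) (congr1 (@cabs R) gx).
have ? := cabs_ge0 p.
rewrite vp cabsM v1 mulr1 cabsR ger0_norm; first by lra.
by rewrite addr_ge0 // divr_ge0 // ltW.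
Qed.

End Quotient.

Lemma schwarz_pick f b t : analytic_on unit_disc f ->
  (forall t, unit_disc t -> unit_disc (f t)) -> cabs b < 1 -> cabs t < 1 ->
  cabs (f t - f b) * cabs (blaschke_den b t)
  <= cabs (t - b) * cabs (blaschke_den (f b) (f t)).
Proof.
move=> fU fD b1 t1.
have fan s : cabs s < 1 -> analytic_at f s by move=> /unit_discE/fU.
have fdisc s : cabs s < 1 -> cabs (f s) < 1 by move=> /unit_discE/fD/unit_discE.
have [->|tb] := eqVneq t b; first by rewrite !subrr cabs0 !mul0r.
have [c fc] := fan b b1.
have Sb : analytic_at (shift_quot f b (c 1%N)) b by exists (fun n => c n.+1); exact: has_pseries_shift.
have := blaschke_quot_le1 fan fdisc b1 Sb t1.
rewrite blaschke_quotE // !cabsM !cabsV.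
have D0 : 0 < cabs (blaschke_den (f b) (f t)).
  by rewrite cabs_gt0 blaschke_den_neq0 // fdisc.
have tb0 : 0 < cabs (t - b) by rewrite cabs_gt0 subr_eq0.
by rewrite mulrA ler_pdivrMr // mul1r mulrAC ler_pdivrMr // [_ * cabs (t - b)]mulrC.
Qed.

End SchwarzPick.

(** * Moebius maps *)

Section ComplexDerivative.
Variable R : realType.
Local Notation C := (Cplx R).
Implicit Types (a b d e t x y mu : C) (f g z w : C -> C) (U : set C).

Lemma is_cderive_cst b a : is_derive a (1 : C) (fun=> b : C) 0.
Proof. exact: (is_derive_cst b a 1). Qed.

Lemma is_cderiveD f g a d e : is_derive a 1 f d -> is_derive a 1 g e ->
  is_derive a 1 (fun t => f t + g t) (d + e).
Proof. by move=> fd ge; exact: (is_deriveD fd ge). Qed.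

Lemma is_cderiveN f a d : is_derive a 1 f d -> is_derive a 1 (fun t => - f t) (- d).
Proof. by move=> fd; exact: (is_deriveN fd). Qed.

Lemma is_cderive_eq f a d e : is_derive a 1 f d -> d = e -> is_derive a 1 f e.
Proof. by move=> fd <-. Qed.

Lemma is_cderiveM f g a d e : is_derive a 1 f d -> is_derive a 1 g e ->
  is_derive a 1 (fun t => f t * g t) (d * g a + f a * e).
Proof.
move=> fd ge; apply: (is_cderive_eq (is_deriveM fd ge)).
by rewrite addrC [d * _]mulrC.
Qed.

Lemma is_cderive_affine b d a : is_derive a (1 : C) (fun t => b + d * t) d.
Proof.
have H : is_derive a (1 : C) (fun t : C => t) 1 by exact: (is_derive_id a (1 : C)).
apply: (is_cderive_eq (is_cderiveD (is_cderive_cst b a) (is_cderiveM (is_cderive_cst d a) H))).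
by rewrite mul0r mulr1 !add0r.
Qed.

Lemma is_cderiveV f a d : is_derive a 1 f d -> f a != 0 ->
  is_derive a 1 (fun t => (f t)^-1) (- d / f a ^+ 2).
Proof.
move=> [fa <-] fa0; split; first exact: derivableV.
by rewrite deriveV // mulNr mulrC -mulNr.
Qed.

Lemma is_cderive_comp f g a d e : is_derive a 1 f d -> is_derive (f a) 1 g e ->
  is_derive a 1 (fun t => g (f t)) (e * d).
Proof.
move=> [fa fd] [ga ge].
have /derivable1_diffP df := fa; have /derivable1_diffP dg := ga.
have dgf : differentiable (g \o f) a by exact: (differentiable_comp df dg).
split; first exact/derivable1_diffP.
have fe : 'd f a (1 : C) = d :> C := etrans (esym (deriveE (1 : C) df)) fd.
have ge1 : 'd g (f a) (1 : C) = e :> C := etrans (esym (deriveE (1 : C) dg)) ge.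
have gfe : 'D_1 (g \o f) a = 'd (g \o f) a (1 : C) := deriveE (1 : C) dgf.
have c1 : 'd (g \o f) a (1 : C) = 'd g (f a) ('d f a (1 : C)) := congr1 (@^~ (1 : C)) (diff_comp df dg).
have c2 : 'd g (f a) d = d * 'd g (f a) (1 : C) :> C.
  by rewrite -[X in 'd _ _ X = _]mulr1 [LHS]linearZ.
have c3 : 'd g (f a) ('d f a (1 : C)) = e * d :> C.
  exact: (etrans (congr1 ('d g (f a)) fe)
          (etrans c2 (etrans (congr1 ( *%R d) ge1) (mulrC d e)))).
exact: (etrans gfe (etrans c1 c3)).
Qed.

Lemma is_cderive_unique f a d e : is_derive a 1 f d -> is_derive a 1 f e -> d = e.
Proof. by move=> [_ <-] [_ <-]. Qed.

Lemma near_is_cderive_eq f g (df dg : C -> C) a :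
  (\forall t \near a, f t = g t) ->
  (\forall t \near a, is_derive t (1 : C) f (df t)) ->
  (\forall t \near a, is_derive t (1 : C) g (dg t)) ->
  \forall t \near a, df t = dg t.
Proof.
move=> /nbhs_interior fg fd gd.
apply: filterS3 fg fd gd => t fgt fdt; apply: is_cderive_unique.
exact: near_eq_is_derive fdt.
Qed.

(** Iterated derivatives are found by exhibiting candidates, each the derivative of the previous
    one; openness of [U] makes each identity hold near [t], so that it can be differentiated
    again. *)
Lemma derive1n_tower U (F : nat -> C -> C) n t : open U ->
  (forall i t, (i < n)%N -> U t -> is_derive t (1 : C) (F i) (F i.+1 t)) ->
  forall i, (i <= n)%N -> U t -> derive1n i (F 0%N) t = F i t.
Proof.
move=> Uo FU i; elim: i t => [//|i IH] t ni Ut.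
rewrite derive1nS derive1E; apply: derive_val.
apply: (near_eq_is_derive _ (FU i t ni Ut)).
by apply: (open_nearW Uo Ut) => s Us; rewrite IH // ltnW.
Qed.

Lemma schwarzian_moebius_alg (A L z1 z2 z3 : C) : L != 0 ->
  z2 * L + 2 * A * z1 = 0 -> z3 * L + z2 * A + (0 * z1 + 2 * A * z2) = 0 ->
  z3 / z1 - 3 / 2 * (z2 / z1) ^+ 2 = 0.
Proof.
move=> L0 e2 e3.
(* When [z1 = 0] both quotients are 0 by the convention on inverses. *)
have [->|z10] := eqVneq z1 0; first by rewrite invr0 !mulr0 expr0n mulr0 subrr.
have -> : z3 = - 3 * A * z2 / L.
  by apply: (canRL (mulfK L0)); apply/eqP; rewrite -subr_eq0 -[0]e3; apply/eqP; ring.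
have -> : z2 = - 2 * A * z1 / L.
  by apply: (canRL (mulfK L0)); apply/eqP; rewrite -subr_eq0 -[0]e2; apply/eqP; ring.
by field; rewrite z10 L0.
Qed.

(** The relation is kept free of quotients: its second derivative has lost [A'] and [B'], and
    together with the third it expresses [z''] and [z'''] through [z']. *)
Lemma schwarzian_moebius z U a (A B A' B' : C) : open U -> analytic_on U z -> U a ->
  B + A * a != 0 -> (\forall t \near a, z t * (B + A * t) = B' + A' * t) ->
  schwarzian z a = 0.
Proof.
move=> Uo zU Ua L0 E0.
have dz n t : U t -> is_derive t (1 : C) (derive1n n z) (derive1n n.+1 z t).
  by move=> Ut; exact: (analytic_on_is_derive n Uo zU Ut).
have dL t := is_cderive_affine B A t.
have E1 : \forall t \near a,
    derive1n 1 z t * (B + A * t) + derive1n 0 z t * A = A'.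
  apply: (near_is_cderive_eq E0); apply: (open_nearW Uo Ua) => t Ut.
    exact: (is_cderiveM (dz 0%N t Ut) (dL t)).
  exact: is_cderive_affine.
have E2 : \forall t \near a,
    derive1n 2 z t * (B + A * t) + derive1n 1 z t * A
    + (derive1n 1 z t * A + derive1n 0 z t * 0) = 0.
  apply: (near_is_cderive_eq E1); apply: (open_nearW Uo Ua) => t Ut.
    exact: (is_cderiveD (is_cderiveM (dz 1%N t Ut) (dL t))
                        (is_cderiveM (dz 0%N t Ut) (is_cderive_cst A t))).
  exact: is_cderive_cst.
have E2' : \forall t \near a,
    derive1n 2 z t * (B + A * t) + 2 * A * derive1n 1 z t = 0.
  have alg (p q r L : C) : p * L + 2 * A * q = p * L + q * A + (q * A + r * 0) by ring.
  apply: filterS E2 => t; exact: etrans (alg _ _ _ _).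
have E3 : \forall t \near a,
    derive1n 3 z t * (B + A * t) + derive1n 2 z t * A
    + (0 * derive1n 1 z t + 2 * A * derive1n 2 z t) = 0.
  apply: (near_is_cderive_eq E2'); apply: (open_nearW Uo Ua) => t Ut.
    exact: (is_cderiveD (is_cderiveM (dz 2%N t Ut) (dL t))
                        (is_cderiveM (is_cderive_cst (2 * A) t) (dz 1%N t Ut))).
  exact: is_cderive_cst.
have e2 := nbhs_singleton E2'; have e3 := nbhs_singleton E3.
exact: (schwarzian_moebius_alg L0 e2 e3).
Qed.

Lemma schwarzian_disc_automorphism z :
  change_of_coordinates unit_disc unit_disc z ->
  forall t, unit_disc t -> schwarzian z t = 0.
Proof.
move=> [Do _ zan zD [w [wan wD wz zw]]] a Da.
have a1 : cabs a < 1 by exact/unit_discE.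
(* A base point distinct from [a], so that the quotient at [a] is an honest difference quotient. *)
pose b : C := if a == 0 then (((2^-1 : R)%:C)%C : C) else 0.
have ab : a != b.
  rewrite /b; case: (eqVneq a 0) => [->|//]; rewrite eq_sym -cabs_eq0 cabsR.
  by rewrite normr_eq0 invr_eq0 pnatr_eq0.
have b1 : cabs b < 1.
  rewrite /b; case: ifP => _; last by rewrite cabs0.
  by rewrite cabsR gtr0_norm ?invr_gt0 // invf_lt1 // ltr1n.
have fan s : cabs s < 1 -> analytic_at z s by move=> /unit_discE/zan.
have fdisc s : cabs s < 1 -> cabs (z s) < 1 by move=> /unit_discE/zD/unit_discE.
have [c zc] := fan b b1.
have Sb : analytic_at (shift_quot z b (c 1%N)) b.
  by exists (fun n => c n.+1); exact: has_pseries_shift zc.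
have Dza : 0 < cabs (blaschke_den (z b) (z a)).
  by rewrite cabs_gt0 blaschke_den_neq0 // fdisc.
have tab : 0 < cabs (a - b) by rewrite cabs_gt0 subr_eq0.
set g := blaschke_quot z b (c 1%N).
have ga1 : cabs (g a) = 1.
  apply/eqP; rewrite eq_le (blaschke_quot_le1 fan fdisc b1 Sb a1) /=.
  rewrite /g blaschke_quotE // !cabsM !cabsV.
  (* For the inverse map, at [z b] and [z a], the inequality reads in the opposite direction. *)
  have := schwarz_pick wan wD (fdisc b b1) (fdisc a a1).
  rewrite !wz //; last exact/unit_discE.
  rewrite mulrA ler_pdivlMr // mul1r mulrAC ler_pdivlMr // mulrC => H.
  by rewrite mulrC in H; rewrite mulrC.
have gloc : \forall t \near a, g t = g a.
  apply: (blaschke_quot_local_max fan fdisc b1 Sb a1).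
  apply: filterS (near_lt_cabs a1) => t t1; rewrite -/g ga1.
  exact: blaschke_quot_le1.
have [mu muE mu1] : exists2 mu, mu = g a & cabs mu = 1 by exists (g a).
pose be := z b.
(* The denominator of the Moebius map at [a]. If it vanished, [blaschke_den b a] would have modulus
   at most [cabs (a - b)], contradicting [blaschke_lt]. *)
have den0 : (1 - mu * be^* * b) + (mu * be^* - b^*) * a != 0.
  have -> : (1 - mu * be^* * b) + (mu * be^* - b^*) * a =
     blaschke_den b a + mu * be^* * (a - b) by rewrite /blaschke_den; ring.
  apply/eqP => /eqP; rewrite addr_eq0 => /eqP E.
  have := blaschke_lt b1 a1; rewrite E cabsN !cabsM mu1 mul1r.
  have -> : cabs be^* = cabs be.
    by case: (be) => u v; rewrite /cabs /= sqrrN.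
  have := fdisc b b1; rewrite -/be => be1; rewrite ltNge => /negP; apply.
  by rewrite ler_piMl ?cabs_ge0 // ltW.
apply: (schwarzian_moebius (B' := be - mu * b) (A' := mu - be * b^*) Do zan Da den0).
apply: filterS3 gloc (near_lt_cabs a1) (near_neq ab) => t gt t1 tb.
have Dt : blaschke_den be (z t) != 0 by rewrite blaschke_den_neq0 // fdisc.
have tb0 : t - b != 0 by rewrite subr_eq0.
have E : (z t - be) * blaschke_den b t = mu * (t - b) * blaschke_den be (z t).
  by rewrite muE -gt /g blaschke_quotE // -/be; field; rewrite ?Dt ?tb0.
rewrite /blaschke_den in E; apply/eqP; rewrite -subr_eq0; apply/eqP.
transitivity ((z t - be) * (1 + - b^* * t) - mu * (t - b) * (1 + - be^* * z t)); first by ring.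
by rewrite E subrr.
Qed.

End ComplexDerivative.

(** * Change of curvatures *)

Section CurvatureTransformation.
Variable R : realType.
Local Notation C := (Cplx R).
Implicit Types (a b d e t : C) (x y z f g : C -> C) (U : set C).
Implicit Types F G Z M L : nat -> C -> C.

(** Explicit derivatives of a product up to order 3, the last branch standing for order 3; [chain3]
    does the same for a composite (Faa di Bruno). *)
Definition leibniz3 F G (n : nat) t : C :=
  match n with
  | 0 => F 0%N t * G 0%N t
  | 1 => F 1%N t * G 0%N t + F 0%N t * G 1%N t
  | 2 => F 2%N t * G 0%N t + 2 * (F 1%N t * G 1%N t) + F 0%N t * G 2%N t
  | _ => F 3%N t * G 0%N t + 3 * (F 2%N t * G 1%N t) + 3 * (F 1%N t * G 2%N t)
         + F 0%N t * G 3%N t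
  end.

Definition chain3 G Z (n : nat) t : C :=
  let g i := G i (Z 0%N t) in
  match n with
  | 0 => g 0%N
  | 1 => Z 1%N t * g 1%N
  | 2 => Z 2%N t * g 1%N + Z 1%N t * Z 1%N t * g 2%N
  | _ => Z 3%N t * g 1%N + 3 * (Z 1%N t * Z 2%N t * g 2%N)
         + Z 1%N t * Z 1%N t * Z 1%N t * g 3%N
  end.

Definition tower3 U F : Prop :=
  forall i t, (i < 3)%N -> U t -> is_derive t (1 : C) (F i) (F i.+1 t).

Lemma tower3_leibniz U F G : tower3 U F -> tower3 U G -> tower3 U (leibniz3 F G).
Proof.
move=> FU GU; case=> [|[|[|//]]] t _ Ut.
- exact: (is_cderiveM (FU 0%N t isT Ut) (GU 0%N t isT Ut)).
- apply: is_cderive_eq (is_cderiveD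
    (is_cderiveM (FU 1%N t isT Ut) (GU 0%N t isT Ut))
    (is_cderiveM (FU 0%N t isT Ut) (GU 1%N t isT Ut))) _.
  by rewrite /=; ring.
apply: is_cderive_eq (is_cderiveD (is_cderiveD
    (is_cderiveM (FU 2%N t isT Ut) (GU 0%N t isT Ut))
    (is_cderiveM (is_cderive_cst 2 t)
       (is_cderiveM (FU 1%N t isT Ut) (GU 1%N t isT Ut))))
    (is_cderiveM (FU 0%N t isT Ut) (GU 2%N t isT Ut))) _.
by rewrite /=; ring.
Qed.

Lemma tower3_chain U V G Z : tower3 V G -> tower3 U Z ->
  (forall t, U t -> V (Z 0%N t)) -> tower3 U (chain3 G Z).
Proof.
move=> GV ZU UV i t i3 Ut; have Vt := UV t Ut.
have gz j : (j < 3)%N -> is_derive t (1 : C) (fun s => G j (Z 0%N s))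
    (G j.+1 (Z 0%N t) * Z 1%N t).
  move=> j3; exact: (is_cderive_comp (ZU 0%N t isT Ut) (GV j _ j3 Vt)).
case: i i3 => [|[|[|//]]] _.
- by apply: is_cderive_eq (gz 0%N isT) _; rewrite /= mulrC.
- apply: is_cderive_eq (is_cderiveM (ZU 1%N t isT Ut) (gz 1%N isT)) _.
  by rewrite /=; ring.
have Z1 := ZU 1%N t isT Ut.
apply: is_cderive_eq (is_cderiveD
  (is_cderiveM (ZU 2%N t isT Ut) (gz 1%N isT))
  (is_cderiveM (is_cderiveM Z1 Z1) (gz 2%N isT))) _.
by rewrite /=; ring.
Qed.

Lemma tower3_derive1n U F i t : open U -> tower3 U F -> (i <= 3)%N -> U t ->
  derive1n i (F 0%N) t = F i t.
Proof. move=> Uo FU i3 Ut; exact: (derive1n_tower Uo FU i3 Ut). Qed.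

Lemma analytic_tower3 U f : open U -> analytic_on U f ->
  tower3 U (fun i => derive1n i f).
Proof. move=> Uo fU i t _ Ut; exact: (analytic_on_is_derive i Uo fU Ut). Qed.

Lemma eq_on_is_cderive U f g t d e : open U -> U t ->
  (forall t, U t -> f t = g t) ->
  is_derive t (1 : C) f d -> is_derive t (1 : C) g e -> d = e.
Proof.
move=> Uo Ut fg fd; apply: is_cderive_unique; apply: near_eq_is_derive fd.
exact: (open_nearW Uo Ut fg).
Qed.

(* [M / L] is locally a constant cube root of unity; in terms of derivatives,
   without division: *)
Lemma eq_cube_tower3 U M L : open U -> tower3 U M -> tower3 U L ->
  (forall t, U t -> M 0%N t ^+ 3 = L 0%N t ^+ 3) -> (forall t, U t -> L 0%N t != 0) ->
  forall i t, (i <= 3)%N -> U t -> M i t * L 0%N t = M 0%N t * L i t.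
Proof.
move=> Uo MU LU ML L0.
have M0 t : U t -> M 0%N t != 0.
  move=> Ut; have : M 0%N t ^+ 3 != 0 by rewrite ML // expf_neq0 // L0.
  by rewrite expf_eq0.
have cube F : tower3 U F -> forall t, U t -> is_derive t (1 : C) (fun s => F 0%N s ^+ 3)
    (3 * F 0%N t ^+ 2 * F 1%N t).
  move=> FU t Ut; have F0 := FU 0%N t isT Ut.
  by apply: is_cderive_eq (is_cderiveM F0 (is_cderiveM F0 F0)) _; ring.
have E1 t : U t -> M 1%N t * L 0%N t = M 0%N t * L 1%N t.
  move=> Ut; have E := eq_on_is_cderive Uo Ut ML (cube M MU t Ut) (cube L LU t Ut).
  have M2 : 3 * M 0%N t ^+ 2 != 0.
    by rewrite mulf_neq0 ?pnatr_eq0 // expf_neq0 // M0.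
  apply: (mulfI M2); rewrite mulrA E.
  have := ML t Ut; move: (M 0%N t) (M 1%N t) (L 0%N t) (L 1%N t) => m0 m1 l0 l1 e.
  transitivity (3 * l0 ^+ 3 * l1); first by ring.
  by rewrite -e; ring.
have E2 t : U t -> M 2%N t * L 0%N t = M 0%N t * L 2%N t.
  move=> Ut; have := eq_on_is_cderive Uo Ut E1
    (is_cderiveM (MU 1%N t isT Ut) (LU 0%N t isT Ut))
    (is_cderiveM (MU 0%N t isT Ut) (LU 1%N t isT Ut)).
  by rewrite addrC => /addrI.
have E3 t : U t -> M 3%N t * L 0%N t = M 0%N t * L 3%N t.
  move=> Ut; have := eq_on_is_cderive Uo Ut E2
    (is_cderiveM (MU 2%N t isT Ut) (LU 0%N t isT Ut))
    (is_cderiveM (MU 0%N t isT Ut) (LU 2%N t isT Ut)).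
  (* After multiplication by [L 0], both sides equal [M 0 * L 1 * L 2] by [E2] and [E1]; the cross
     terms of the differentiated identity then cancel. *)
  have -> : M 2%N t * L 1%N t = M 1%N t * L 2%N t.
    apply: (mulIf (L0 t Ut)); rewrite mulrAC E2 // [RHS]mulrAC E1 //.
    by rewrite mulrAC.
  by rewrite addrC => /addrI.
by case=> [|[|[|[|//]]]] t _ Ut; [|exact: E1|exact: E2|exact: E3].
Qed.

(* [l], [m] are the normalisations of the two liftings and [p1], [p2], [p3] the
   derivatives of a coordinate of the curve. *)
Lemma curvature_change (K : numFieldType)
    (w z1 z2 z3 z4 l0 l1 l2 l3 m0 m1 m2 m3 k0 k1 q0 q1 p1 p2 p3 : K) :
  z1 != 0 -> l0 != 0 -> m0 != 0 -> p1 != 0 ->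
  m0 * z1 = w * l0 ->
  m1 * z1 + m0 * z2 = w * (z1 * l1) ->
  m2 * z1 + 2 * (m1 * z2) + m0 * z3 = w * (z2 * l1 + z1 * z1 * l2) ->
  m3 * z1 + 3 * (m2 * z2) + 3 * (m1 * z3) + m0 * z4
    = w * (z3 * l1 + 3 * (z1 * z2 * l2) + z1 * z1 * z1 * l3) ->
  l3 = k0 * l0 + k1 * l1 -> m3 = q0 * m0 + q1 * m1 ->
  3 * (l2 * p1) + 3 * (l1 * p2) + l0 * p3 = k1 * (l0 * p1) ->
  3 * (m2 * (z1 * p1)) + 3 * (m1 * (z2 * p1 + z1 * z1 * p2))
    + m0 * (z3 * p1 + 3 * (z1 * z2 * p2) + z1 * z1 * z1 * p3)
    = q1 * (m0 * (z1 * p1)) ->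
  q1 = z1 ^+ 2 * k1 - 2 * (z3 / z1 - 3 / 2 * (z2 / z1) ^+ 2) /\
  q0 = z1 ^+ 3 * k0 + z1 * z2 * k1
       - (z4 / z1 - z3 * z2 / z1 ^+ 2
          - 3 * (z2 / z1) * (z3 / z1 - z2 ^+ 2 / z1 ^+ 2)).
Proof.
move=> z10 l00 m00 p10 M0 M1 M2 M3 l3E m3E ep eq.
have p3E : p3 = (k1 * (l0 * p1) - 3 * (l2 * p1) - 3 * (l1 * p2)) / l0.
  by rewrite -ep; field.
have wE : w = m0 * z1 / l0 by rewrite M0; field.
have m1E : m1 = (w * (z1 * l1) - m0 * z2) / z1 by rewrite -M1; field.
have m2E : m2 = (w * (z2 * l1 + z1 * z1 * l2) - 2 * (m1 * z2) - m0 * z3) / z1.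
  by rewrite -M2; field.
have m3E' : m3 = (w * (z3 * l1 + 3 * (z1 * z2 * l2) + z1 * z1 * z1 * l3)
    - 3 * (m2 * z2) - 3 * (m1 * z3) - m0 * z4) / z1 by rewrite -M3; field.
have q1E : q1 = z1 ^+ 2 * k1 - 2 * (z3 / z1 - 3 / 2 * (z2 / z1) ^+ 2).
  have d0 : m0 * (z1 * p1) != 0 by rewrite !mulf_neq0.
  apply: (mulIf d0); rewrite -eq p3E m2E m1E wE; field.
  by rewrite l00 z10.
split=> //.
(* The constant coordinate 1 of the lifting gives the equation of the normalisation itself, from
   which [q0] follows once [q1] is known. *)
have q0E : q0 = (m3 - q1 * m1) / m0 by rewrite m3E; field.
rewrite q0E m3E' q1E m2E m1E wE l3E; field.
by rewrite ?l00 ?z10 ?m00.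
Qed.

Lemma derive1n_cst (b : C) n t : derive1n n.+1 (fun=> b) t = 0.
Proof.
elim: n t => [|n IH] t; first exact: derive1_cst.
rewrite derive1nS (_ : derive1n n.+1 (fun=> b) = fun=> 0); first exact: derive1_cst.
by apply/funext.
Qed.

Lemma det_mx33 (K : comPzRingType) (E : nat -> nat -> K) :
  \det (\matrix_(i < 3, j < 3) E i j) =
    E 0%N 0%N * (E 1%N 1%N * E 2%N 2%N - E 1%N 2%N * E 2%N 1%N)
    - E 0%N 1%N * (E 1%N 0%N * E 2%N 2%N - E 1%N 2%N * E 2%N 0%N)
    + E 0%N 2%N * (E 1%N 0%N * E 2%N 1%N - E 1%N 1%N * E 2%N 0%N).
Proof.
rewrite (expand_det_row _ ord0) !big_ord_recl big_ord0 !mxE /=.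
rewrite /cofactor !(expand_det_row _ ord0) !big_ord_recl !big_ord0 /cofactor.
by rewrite !det_mx11 !mxE /= /bump /=; ring.
Qed.

Lemma wronskian_affine x y t : wronskian (affine_lift x y) t =
  derive1n 1 x t * derive1n 2 y t - derive1n 2 x t * derive1n 1 y t.
Proof.
pose E i j := derive1n j (fun s => [:: 1; x s; y s]`_i) t.
have -> : wronskian (affine_lift x y) t = \det (\matrix_(i < 3, j < 3) E i j).
  congr determinant; apply/matrixP => i j; rewrite !mxE /E.
  by congr (derive1n _ _ _); apply/funext => s; rewrite mxE.
have e00 : E 0%N 0%N = 1 := erefl.
have e01 : E 0%N 1%N = 0 := derive1n_cst 1 0 t.
have e02 : E 0%N 2%N = 0 := derive1n_cst 1 1 t.
transitivity (E 1%N 1%N * E 2%N 2%N - E 1%N 2%N * E 2%N 1%N); last exact: erefl.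
rewrite det_mx33; move: e00 e01 e02; clearbody E => -> -> ->.
by rewrite !mul0r mul1r subr0 addr0.
Qed.

End CurvatureTransformation.

(** * The third order equation in coordinates, and the derivative of the Schwarzian *)

Section CurvatureEquation.
Variable R : realType.
Local Notation C := (Cplx R).

Lemma curvature_equation (U : set C) (f : C -> 'cV[C]_3) (lambda k0 k1 : C -> C)
    (L P : nat -> C -> C) (i : 'I_3) : open U ->
  (forall t, U t -> vderive 3 (fun s => lambda s *: f s) t =
     k0 t *: (lambda t *: f t) + k1 t *: vderive 1 (fun s => lambda s *: f s) t) ->
  tower3 U L -> L 0%N = lambda -> tower3 U P -> (forall t, f t i 0 = P 0%N t) ->
  forall t, U t -> leibniz3 L P 3 t =
    k0 t * leibniz3 L P 0 t + k1 t * leibniz3 L P 1 t.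
Proof.
move=> Uo ode LU L0 PU P0 t Ut.
have LP := tower3_leibniz LU PU.
have fE : (fun s => (lambda s *: f s) i 0) = leibniz3 L P 0.
  by apply/funext => s; rewrite mxE P0 -L0.
have vE n : (n <= 3)%N -> vderive n (fun s => lambda s *: f s) t i 0 = leibniz3 L P n t.
  by move=> n3; rewrite mxE fE; exact: (tower3_derive1n Uo LP n3 Ut).
rewrite -(vE 3%N) // (ode t Ut) mxE [X in X + _]mxE [X in _ + X]mxE (vE 1%N) //.
by rewrite (congr1 (@^~ t) fE).
Qed.

Lemma is_cderive_derive1 (f : C -> C) (a d : C) : is_derive a 1 f d -> d = derive1 f a.
Proof. by move=> [_ <-]; rewrite derive1E. Qed.

Lemma is_cderive_schwarzian (U : set C) (z : C -> C) t : open U -> analytic_on U z ->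
  U t -> derive1n 1 z t != 0 ->
  is_derive t (1 : C) (schwarzian z)
    (derive1n 4 z t / derive1n 1 z t
     - derive1n 3 z t * derive1n 2 z t / derive1n 1 z t ^+ 2
     - 3 * (derive1n 2 z t / derive1n 1 z t)
       * (derive1n 3 z t / derive1n 1 z t
          - derive1n 2 z t ^+ 2 / derive1n 1 z t ^+ 2)).
Proof.
move=> Uo zU Ut z10.
have dz n := analytic_on_is_derive n Uo zU Ut.
have dV := is_cderiveV (dz 1%N) z10.
have dq := is_cderiveM (dz 2%N) dV.
apply: is_cderive_eq (is_cderiveD (is_cderiveM (dz 3%N) dV)
  (is_cderiveN (is_cderiveM (is_cderive_cst (3 / 2) t) (is_cderiveM dq dq)))) _.
move: z10; move: (derive1n 1 z t) (derive1n 2 z t) (derive1n 3 z t) (derive1n 4 z t).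
by move=> z1 z2 z3 z4 z10; field.
Qed.

End CurvatureEquation.

(** The first two conclusions allow any coordinate domain mapped into the disc; the third takes the
    change of coordinates to be an automorphism of the disc. *)
Theorem mainTheorem8 (R : realType) (x y kappa0 kappa1 : Cplx R -> Cplx R)
    (U V : set (Cplx R)) (z tkappa0 tkappa1 : Cplx R -> Cplx R) :
  analytic_on unit_disc x -> analytic_on unit_disc y ->
  (forall t, unit_disc t ->
    derive1n 1 x t * derive1n 2 y t - derive1n 2 x t * derive1n 1 y t != 0) ->
  schwarzian_curvatures unit_disc (affine_lift x y) kappa0 kappa1 ->
  V `<=` unit_disc -> change_of_coordinates U V z ->
  schwarzian_curvatures U (affine_lift (x \o z) (y \o z)) tkappa0 tkappa1 ->
  [/\ (forall t, U t ->
        tkappa1 t = derive1n 1 z t ^+ 2 * kappa1 (z t) - 2 * schwarzian z t),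
      (forall t, U t ->
        tkappa0 t = derive1n 1 z t ^+ 3 * kappa0 (z t)
                    + derive1n 1 z t * derive1n 2 z t * kappa1 (z t)
                    - derive1n 1 (schwarzian z) t) &
      (U = unit_disc -> V = unit_disc -> forall t, U t ->
        tkappa0 t = derive1n 1 z t ^+ 3 * kappa0 (z t)
                    + derive1n 1 z t * derive1n 2 z t * kappa1 (z t)
                    - schwarzian z t)].
Proof.
move=> xan yan W0 [l [lan l0 lW lode]] VD zchange [m [man m0 mW mode]].
have [Uo _ zan zV _] := zchange.
have Do := @unit_disc_open R.
have zD t : U t -> unit_disc (z t) by move=> /zV/VD.
pose X i := derive1n i x; pose Y i := derive1n i y; pose Z i := derive1n i z.
pose L i := derive1n i l; pose M i := derive1n i m.
have XT : tower3 unit_disc X := analytic_tower3 Do xan.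
have YT : tower3 unit_disc Y := analytic_tower3 Do yan.
have ZT : tower3 U Z := analytic_tower3 Uo zan.
have LT : tower3 unit_disc L := analytic_tower3 Do lan.
have MT : tower3 U M := analytic_tower3 Uo man.
have Z'T : tower3 U (fun i => Z i.+1).
  by move=> i t _ Ut; exact: (analytic_on_is_derive i.+1 Uo zan Ut).
pose one i : Cplx R -> Cplx R := if i is 0%N then fun=> 1 else fun=> 0.
have oneT A : tower3 A one by move=> [|i] t _ _; exact: is_cderive_cst.
have XZ := tower3_chain XT ZT zD; have YZ := tower3_chain YT ZT zD.
have LZ := tower3_chain LT ZT zD.
have MZ' := tower3_leibniz MT Z'T.
(* The terms in [z''] cancel in the determinant. *)
have WZ t : U t -> wronskian (affine_lift (x \o z) (y \o z)) t =
    Z 1%N t ^+ 3 * wronskian (affine_lift x y) (z t).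
  move=> Ut; rewrite !wronskian_affine.
  have xE i : (i <= 3)%N -> derive1n i (x \o z) t = chain3 X Z i t.
    by move=> i3; exact: (tower3_derive1n Uo XZ i3 Ut).
  have yE i : (i <= 3)%N -> derive1n i (y \o z) t = chain3 Y Z i t.
    by move=> i3; exact: (tower3_derive1n Uo YZ i3 Ut).
  rewrite (xE 1%N isT) (xE 2%N isT) (yE 1%N isT) (yE 2%N isT) /chain3.
  rewrite -[derive1n 1 x _]/(X 1%N (z t)) -[derive1n 2 x _]/(X 2%N (z t)).
  rewrite -[derive1n 1 y _]/(Y 1%N (z t)) -[derive1n 2 y _]/(Y 2%N (z t)).
  rewrite -[Z 0%N t]/(z t).
  move: (X 1%N _) (X 2%N _) (Y 1%N _) (Y 2%N _) (Z 1%N t) (Z 2%N t).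
  by move=> *; ring.
(* Forced by the normalisation of the second lifting, whose Wronskian contains the factor
   [z' ^+ 3]. *)
have Z10 t : U t -> Z 1%N t != 0.
  move=> Ut; apply/eqP => Z1; have := mW t Ut.
  by rewrite WZ // Z1 expr0n mul0r mulr0 => /eqP; rewrite eq_sym oner_eq0.
have cubes t : U t -> leibniz3 M (fun i => Z i.+1) 0 t ^+ 3 = chain3 L Z 0 t ^+ 3.
  move=> Ut; have lw := lW (z t) (zD t Ut); have mw := mW t Ut.
  rewrite WZ // in mw.
  have w0 : wronskian (affine_lift x y) (z t) != 0.
    by apply/eqP => w0; move/eqP: lw; rewrite w0 mulr0 eq_sym oner_eq0.
  by apply: (mulIf w0); rewrite [LHS](_ : _ = 1) ?[RHS]lw // exprMn -mulrA.
have ratio := eq_cube_tower3 Uo MZ' LZ cubes (fun t Ut => l0 (z t) (zD t Ut)).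
have key t : U t ->
    tkappa1 t = Z 1%N t ^+ 2 * kappa1 (z t) - 2 * (Z 3%N t / Z 1%N t
       - 3 / 2 * (Z 2%N t / Z 1%N t) ^+ 2) /\
    tkappa0 t = Z 1%N t ^+ 3 * kappa0 (z t) + Z 1%N t * Z 2%N t * kappa1 (z t)
       - (Z 4%N t / Z 1%N t - Z 3%N t * Z 2%N t / Z 1%N t ^+ 2
          - 3 * (Z 2%N t / Z 1%N t)
            * (Z 3%N t / Z 1%N t - Z 2%N t ^+ 2 / Z 1%N t ^+ 2)).
  move=> Ut; have Dzt := zD t Ut.
  have one_alg (a0 a1 a2 a3 c0 c1 : Cplx R) :
      a3 * 1 + 3 * (a2 * 0) + 3 * (a1 * 0) + a0 * 0
        = c0 * (a0 * 1) + c1 * (a1 * 1 + a0 * 0) -> a3 = c0 * a0 + c1 * a1.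
    by rewrite !mulr0 !addr0 !mulr1.
  have l3E : L 3%N (z t) = kappa0 (z t) * L 0%N (z t) + kappa1 (z t) * L 1%N (z t).
    have := curvature_equation (i := 0) Do lode LT erefl (oneT _) _ Dzt.
    by move=> /(_ (fun s => mxE _ _ _ _)); exact: one_alg.
  have m3E : M 3%N t = tkappa0 t * M 0%N t + tkappa1 t * M 1%N t.
    have := curvature_equation (i := 0) Uo mode MT erefl (oneT _) _ Ut.
    by move=> /(_ (fun s => mxE _ _ _ _)); exact: one_alg.
  (* Subtracting the coordinate times the equation of the normalisation eliminates [kappa_0],
     leaving an equation for [kappa_1] alone. *)
  have cancel (a0 a1 a2 a3 b0 b1 b2 b3 c0 c1 : Cplx R) :
      a3 = c0 * a0 + c1 * a1 ->
      a3 * b0 + 3 * (a2 * b1) + 3 * (a1 * b2) + a0 * b3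
        = c0 * (a0 * b0) + c1 * (a1 * b0 + a0 * b1) ->
      3 * (a2 * b1) + 3 * (a1 * b2) + a0 * b3 = c1 * (a0 * b1).
    move=> -> E; apply: (addrI ((c0 * a0 + c1 * a1) * b0)).
    by rewrite !addrA E; ring.
  (* A coordinate with nonzero derivative at [z t], by which [kappa_1] can be solved for; [x'] and
     [y'] do not vanish together since [x'y'' - x''y'] is nonzero. The choice may depend on [t]. *)
  have [P [i [PT P1 Pc PZ]]] : exists (P : nat -> Cplx R -> Cplx R) (i : 'I_3),
      [/\ tower3 unit_disc P, P 1%N (z t) != 0,
        forall s, affine_lift x y s i 0 = P 0%N s &
        forall s, affine_lift (x \o z) (y \o z) s i 0 = chain3 P Z 0 s].
    have [X0|X0] := eqVneq (X 1%N (z t)) 0; last first.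
      exists X, 1; split=> // s; exact: mxE.
    exists Y, 2; split=> //; [|by move=> s; exact: mxE|by move=> s; exact: mxE].
    apply/eqP => Y0; have /eqP := W0 _ Dzt; apply.
    have e1 : derive1n 1 x (z t) = 0 := X0.
    have e2 : derive1n 1 y (z t) = 0 := Y0.
    by rewrite e1 e2 mul0r mulr0 subrr.
  have PE := curvature_equation Do lode LT erefl PT Pc Dzt.
  have QE := curvature_equation Uo mode MT erefl (tower3_chain PT ZT zD) PZ Ut.
  pose w : Cplx R := M 0%N t * Z 1%N t / L 0%N (z t).
  have Lz0 : L 0%N (z t) != 0 := l0 _ Dzt.
  have wE i0 : (i0 <= 3)%N -> leibniz3 M (fun i => Z i.+1) i0 t = w * chain3 L Z i0 t.
    move=> i3; apply: (mulIf Lz0).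
    by rewrite [LHS](ratio i0 t i3 Ut) /w [RHS]mulrAC divfK.
  exact: (curvature_change (Z10 t Ut) Lz0 (m0 t Ut) P1 (wE 0%N isT) (wE 1%N isT)
    (wE 2%N isT) (wE 3%N isT) l3E m3E (cancel _ _ _ _ _ _ _ _ _ _ l3E PE)
    (cancel _ _ _ _ _ _ _ _ _ _ m3E QE)).
have dS t (Ut : U t) := is_cderive_schwarzian Uo zan Ut (Z10 t Ut).
have dSE t (Ut : U t) := is_cderive_derive1 (dS t Ut).
split=> [t Ut|t Ut|UD VD' t Ut].
- exact: (key t Ut).1.
- by rewrite (key t Ut).2; congr (_ - _); exact: dSE.
have S0 s : U s -> schwarzian z s = 0.
  move=> Us; apply: schwarzian_disc_automorphism; last by rewrite -UD.
  by rewrite -{1}UD -VD'.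
(* What [key] subtracts is the expanded derivative of [S z], equal to 0 because [S z] vanishes on
   the open set [U]. *)
rewrite (key t Ut).2 S0 //; congr (_ - _).
exact: (eq_on_is_cderive Uo Ut S0 (dS t Ut) (is_cderive_cst 0 t)).
Qed.
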